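(* Let $Q=(Q_0,Q_1)$ be a finite connected quiver. There exist dense open subsets $U_{Q_2^I}\subset\mathbb{C}^{Q_2^I}$, one for each weak cut $I$ of $Q$, having the vanishing property (V) stated in the context, such that, calling a potential $W=\sum_{w\in Q_2}\nu_w w$ generic when $(\nu_w)_{w\in Q_2}$ lies in the dense open subset $\bigcap_{I}p_I^{-1}(U_{Q_2^I})$ of $\mathbb{C}^{Q_2}$ (intersection over all weak cuts $I$), the following holds. If $W$ is generic and there exists a self-stable Abelian representation of $(Q,W)$, then for each weak cut $I$ of $Q$: $$|I|\le |Q_1-I|-|Q_0|+1 .$$
   Context: $Q_0$ is the set of nodes, $Q_1$ the set of arrows $a$ (with source $s(a)$ and target $t(a)$), and $Q_2$ the set of simple oriented cycles, i.e. oriented cycles (up to cyclic rotation) passing at most once through each node. A weak cut is a subset $I\subset Q_1$ such that every $w\in Q_2$ contains at most one arrow of $I$. For a weak cut $I$, $Q_2^I\subset Q_2$ is the set of simple oriented cycles containing exactly one arrow of $I$, and $p_I:\mathbb{C}^{Q_2}\to\mathbb{C}^{Q_2^I}$ is the natural projection. An Abelian representation of $Q$ (dimension vector $(1,\dots,1)$, over $\mathbb{C}$) is a family $\phi=(\phi_a)_{a\in Q_1}\in\mathbb{C}^{Q_1}$. A potential is a linear combination $W=\sum_{w}\nu_w w$ of simple oriented cycles, $\nu_w\in\mathbb{C}$; on Abelian representations it is the polynomial function $W(\phi)=\sum_w\nu_w\prod_{a\in w}\phi_a$. An Abelian representation of $(Q,W)$ is an Abelian representation $\phi$ of $Q$ such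 that $\partial W/\partial\phi_a=0$ at $\phi$ for all $a\in Q_1$. Property (V) for $U_{Q_2^I}$: for every $(\nu_w)_{w\in Q_2^I}\in U_{Q_2^I}$ and every Abelian representation $\phi$ of $(Q,\sum_{w\in Q_2^I}\nu_w w)$, one has $\prod_{a\in w}\phi_a=0$ for all $w\in Q_2^I$. Self-stability: for Abelian representations, let $\zeta_i=\#\{a\in Q_1: t(a)=i\}-\#\{a\in Q_1:s(a)=i\}$ for $i\in Q_0$ (equivalently $\zeta_i=-\sum_{j\ne i}\kappa_{ij}$ with $\kappa_{ij}$ the signed number of arrows from $i$ to $j$); then $\sum_i\zeta_i=0$. A subrepresentation of $\phi$ corresponds to a subset $S\subset Q_0$ such that $s(a)\in S$ and $\phi_a\neq0$ imply $t(a)\in S$. $\phi$ is self-stable if $\sum_{i\in S}\zeta_i<0$ for every such $S$ with $\emptyset\neq S\subsetneq Q_0$. *)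

(* Defs.v *)
From HB Require Import structures.
From mathcomp Require Import all_boot all_order all_algebra.
From mathcomp Require Import complex.
From mathcomp Require Import boolp classical_sets reals topology normedtype derive.

Set Implicit Arguments.
Unset Strict Implicit.
Unset Printing Implicit Defensive.

Import Order.TTheory GRing.Theory Num.Theory.
Import numFieldNormedType.Exports.

Local Open Scope ring_scope.
Local Open Scope complex_scope.

Record quiver := Quiver {
  node : finType;
  arrow : finType;
  src : arrow -> node;
  tgt : arrow -> node }.

Definition adjacent (Q : quiver) : rel (node Q) :=
  fun i j => [exists a : arrow Q,
    ((src a == i) && (tgt a == j)) || ((src a == j) && (tgt a == i))].

Definition connected_quiver (Q : quiver) : Prop :=
  (0 < #|node Q|)%N /\ forall i j : node Q, connect (@adjacent Q) i j.

(* The nodes through which a closed path passes are the sources of its arrows;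
   loops are allowed. *)
Definition is_simple_cycle (Q : quiver) (c : seq (arrow Q)) : bool :=
  [&& c != [::], cycle (fun a b => tgt a == src b) c & uniq (map (@src Q) c)].

(* By [simple_cycle_rot] below, a simple oriented cycle up to rotation is the
   same thing as its set of arrows; Q_2 is therefore a set of sets of arrows. *)
Definition simple_cycles (Q : quiver) : {set {set arrow Q}} :=
  finset (fun w : {set arrow Q} =>
    [exists c : #|w|.-tuple (arrow Q), is_simple_cycle c && (w == finset (mem c))]).

Lemma simple_cyclesP (Q : quiver) (w : {set arrow Q}) :
  reflect (exists2 c : seq (arrow Q), is_simple_cycle c & c =i w)
          (w \in simple_cycles Q).
Proof.
apply: (iffP idP) => [|[c hc cw]].
  rewrite inE => /existsP[c /andP[hc /eqP wE]]; exists c => // a.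
  by rewrite [in RHS]wE inE.
have uc : uniq c by case/and3P: hc => _ _ /map_uniq.
have sc : size c == #|w| by rewrite -(card_uniqP uc) (eq_card cw).
rewrite inE; apply/existsP; exists (Tuple sc); rewrite hc /=.
by apply/eqP/setP => a; rewrite inE -cw.
Qed.

Lemma simple_cycle_rot (Q : quiver) (c d : seq (arrow Q)) :
  is_simple_cycle c -> is_simple_cycle d ->
  (c =i d <-> exists k, d = rot k c).
Proof.
move=> hc hd; split=> [cd|[k ->] a]; last by rewrite mem_rot.
have [_ cc usc] := and3P hc; have [nd dd usd] := and3P hd.
have uc := map_uniq usc; have ud := map_uniq usd.
have srcI : {in c &, injective (@src Q)}.
  move=> a b ac bc sab; rewrite -(nth_index a ac) -(nth_index a bc).
  congr nth; apply/eqP; rewrite -(nth_uniq (src a) _ _ usc) ?size_map ?index_mem //.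
  by rewrite !(nth_map a) ?index_mem // !nth_index // sab.
case: d nd => [//|a p] _ in hd cd dd usd ud *.
have ac : a \in c by rewrite cd mem_head.
have [k q rc] := rot_to ac; exists k; rewrite rc.
have fc : fcycle (next c) (a :: q) by rewrite -rc rot_cycle cycle_next.
have fd : fcycle (next c) (a :: p).
  apply: (sub_in_cycle (P := mem c) _ _ dd); last by apply/allP => x; rewrite -cd.
  move=> x y xc yc /eqP xy; apply/eqP; apply: (srcI _ _ _ yc); rewrite ?mem_next // -xy.
  by apply/esym/eqP; exact: (next_cycle cc).
have /= sz : size (a :: p) = size (a :: q).
  by rewrite -rc size_rot; apply/eqP; rewrite -(uniq_size_uniq uc) // => x; rewrite cd.
move: fc fd; rewrite /= !rcons_path => /andP[/fpathP[m qE] _] /andP[/fpathP[n pE] _].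
move: sz; rewrite pE qE !size_traject => -[->].
by [].
Qed.

Definition weak_cut (Q : quiver) (I : {set arrow Q}) : bool :=
  [forall w in simple_cycles Q, #|w :&: I| <= 1]%N.

(* Q_2^I *)
Definition cut_cycles (Q : quiver) (I : {set arrow Q}) : {set {set arrow Q}} :=
  finset (fun w => (w \in simple_cycles Q) && (#|w :&: I| == 1)%N).

Lemma cut_cycles_sub (Q : quiver) (I : {set arrow Q}) :
  cut_cycles I \subset simple_cycles Q.
Proof. by apply/fintype.subsetP => w; rewrite inE => /andP[]. Qed.

Definition abelian_rep (R : realType) (Q : quiver) := arrow Q -> R[i].

(* C^K, for a set K of cycles, with the product topology; the regular
   algebra R[i]^o is what carries the usual topology of C. *)
Definition coeffs (R : realType) (Q : quiver) (K : {set {set arrow Q}}) :=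
  {ptws {w | w \in K} -> R[i]^o}.

Definition potential (R : realType) (Q : quiver) (K : {set {set arrow Q}})
    (nu : coeffs R K) (phi : abelian_rep R Q) : R[i] :=
  \sum_(w : {w | w \in K}) nu w * \prod_(a in val w) phi a.

(* complex derivative of F at phi in the coordinate phi_a *)
Definition partial (R : realType) (Q : quiver) (F : abelian_rep R Q -> R[i])
    (a : arrow Q) (phi : abelian_rep R Q) : R[i] :=
  derive1 (fun z : R[i] => F [eta phi with a |-> z] : R[i]^o) (phi a).

Definition is_abelian_rep (R : realType) (Q : quiver) (K : {set {set arrow Q}})
    (nu : coeffs R K) (phi : abelian_rep R Q) : Prop :=
  forall a : arrow Q, partial (potential nu) a phi = 0.

Definition vanishing (R : realType) (Q : quiver) (I : {set arrow Q})
    (U : set (coeffs R (cut_cycles I))) : Prop :=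
  forall nu : coeffs R (cut_cycles I), U nu ->
  forall phi : abelian_rep R Q, is_abelian_rep nu phi ->
  forall w : {set arrow Q}, w \in cut_cycles I -> \prod_(a in w) phi a = 0.

(* the projection p_I *)
Definition cut_proj (R : realType) (Q : quiver) (I : {set arrow Q})
    (nu : coeffs R (simple_cycles Q)) : coeffs R (cut_cycles I) :=
  fun w => nu (exist _ (val w) (fintype.subsetP (cut_cycles_sub I) _ (valP w))).

Definition generic (R : realType) (Q : quiver)
    (U : forall I : {set arrow Q}, set (coeffs R (cut_cycles I))) :
    set (coeffs R (simple_cycles Q)) :=
  (\bigcap_(I in mkset (@weak_cut Q)) (@cut_proj R Q I @^-1` U I))%classic.

Definition zeta (Q : quiver) (i : node Q) : int :=
  #|finset (fun a : arrow Q => tgt a == i)|%:Z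
  - #|finset (fun a : arrow Q => src a == i)|%:Z.

Definition is_subrep (R : realType) (Q : quiver) (phi : abelian_rep R Q)
    (S : {set node Q}) : Prop :=
  forall a : arrow Q, src a \in S -> phi a != 0 -> tgt a \in S.

Definition self_stable (R : realType) (Q : quiver) (phi : abelian_rep R Q) : Prop :=
  forall S : {set node Q}, is_subrep phi S -> S != finset.set0 -> S != [set: node Q] ->
  \sum_(i in S) zeta i < 0.

(* Main.v *)
Require Import Defs.
From mathcomp Require Import all_boot all_order all_algebra.
From mathcomp Require Import complex.
From mathcomp Require Import boolp classical_sets functions cardinality.
From mathcomp Require Import reals ereal topology normedtype derive.
From mathcomp Require Import lebesgue_measure.
From mathcomp Require Import ring zify.

Set Implicit Arguments.
Unset Strict Implicit.
Unset Printing Implicit Defensive.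

Import Order.TTheory GRing.Theory Num.Theory.
Import numFieldNormedType.Exports.

Local Open Scope ring_scope.
Local Open Scope complex_scope.

(** Write n = |Q_0|. For a critical point phi of W_I with a nonvanishing cycle of Q_2^I, the
    vector y_w = nu_w prod_(a in w) phi_a lies in the kernel of the incidence matrix, and
    nu_w = y_w prod_(a in w) phi_a^-1. Counting monomials, and using that scaling the arrows
    of I scales W_I, shows that such nu satisfy a nontrivial polynomial relation, so U_I can
    be taken to be the nonvanishing locus of a polynomial.

    A potential f on the nodes gives the arrow a the weight 1_I(a) + f(s(a)) - f(t(a)); every
    cycle of Q_2^I then has total weight 1. Perturbing zeta to a generic stability theta, an
    integer linear program degenerates a self-stable representation of (Q, W) to a
    theta-stable critical point phi of W_I supported on arrows of weight 0, that is, a fixed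
    point of the scaling of I. Choose such a pair with sum_i theta_i f_i minimal. Then phi is
    the only critical point in phi + (arrows of weight >= 1), since another one has, by the
    vanishing property, no cycle of Q_2^I in its support and so degenerates to a pair with a
    smaller value. On the arrows of weight >= m the critical equations are the weighted
    homogeneous equations attached to the arrows of weight <= 1 - m, n - 1 of which are
    redundant for m = 1 by gauge invariance. As a homogeneous system with more unknowns than
    equations has a nontrivial zero, #{weight >= m} <= #{weight <= 1 - m}, with the left side
    increased by n - 1 if m = 1. Summing over m,
    |I| <= |I| - sum_i zeta_i f_i = sum_a weight(a) <= #{weight >= 1} <= (|Q_1| - n + 1) / 2. *)

(** * Polynomial functions *)

(** The coefficient matrix has more rows than columns, hence a nonzero left kernel vector. All the
    dimension counts below rest on this. *)
Lemma dep_of_span (F : fieldType) (X : Type) (S U : finType) (v : S -> X -> F) (u : U -> X -> F) :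
  (forall i, exists b : U -> F, forall x, v i x = \sum_j b j * u j x) ->
  (#|U| < #|S|)%N ->
  exists2 c : S -> F, exists i, c i != 0 & forall x, \sum_i c i * v i x = 0.
Proof.
move=> /choice[B vE] ltUS.
pose M : 'M[F]_(#|S|, #|U|) := \matrix_(i, j) B (enum_val i) (enum_val j).
have rk : \rank (kermx M) != 0%N.
  by rewrite mxrank_ker -lt0n subn_gt0 (leq_ltn_trans (rank_leq_col _)).
have /rowV0Pn[r /sub_kermxP rM r0] : kermx M != 0 by rewrite -mxrank_eq0.
exists (fun i => r 0 (enum_rank i)).
  have /existsP[i ri] : [exists i, r 0 i != 0].
    apply: contraNT r0 => /existsPn r0; apply/eqP/rowP => i; rewrite mxE.
    by apply/eqP; move: (r0 i); rewrite negbK.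
  by exists (enum_val i); rewrite enum_valK.
move=> x; under eq_bigr do rewrite vE mulr_sumr.
rewrite exchange_big big1 //= => j _; under eq_bigr do rewrite mulrA.
rewrite -mulr_suml; have := congr1 (fun m : 'M_(_, _) => m 0 (enum_rank j)) rM.
rewrite !mxE (reindex (enum_rank : S -> _)) /=; last first.
  by exists enum_val => i _; rewrite ?enum_rankK ?enum_valK.
under eq_bigr do rewrite mxE !enum_rankK.
by move=> ->; rewrite mul0r.
Qed.

(** Polynomials are handled as functions closed under the ring operations, which gives induction
    over an arbitrary index type without formal multivariate polynomials. *)
Inductive polyfun (F : comNzRingType) (T : Type) : ((T -> F) -> F) -> Prop :=
| polyfun_cst c : polyfun (fun _ => c)
| polyfun_coord i : polyfun (fun x => x i)
| polyfunD p q : polyfun p -> polyfun q -> polyfun (fun x => p x + q x)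
| polyfunM p q : polyfun p -> polyfun q -> polyfun (fun x => p x * q x).

Section Polyfun.
Variables (F : comNzRingType).

Lemma polyfun_ext (T : Type) (p q : (T -> F) -> F) : p =1 q -> polyfun p -> polyfun q.
Proof. by move=> /funext->. Qed.

Lemma polyfun_sum (T : Type) (I : Type) (r : seq I) (P : pred I) (p : I -> (T -> F) -> F) :
  (forall i, P i -> polyfun (p i)) -> polyfun (fun x => \sum_(i <- r | P i) p i x).
Proof.
move=> pP; elim: r => [|i r IH].
  by apply: polyfun_ext (polyfun_cst T 0) => x; rewrite big_nil.
case Pi: (P i); last by apply: polyfun_ext IH => x; rewrite big_cons Pi.
by apply: polyfun_ext (polyfunD (pP _ Pi) IH) => x; rewrite big_cons Pi.
Qed.

Lemma polyfun_prod (T : Type) (I : Type) (r : seq I) (P : pred I) (p : I -> (T -> F) -> F) :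
  (forall i, P i -> polyfun (p i)) -> polyfun (fun x => \prod_(i <- r | P i) p i x).
Proof.
move=> pP; elim: r => [|i r IH].
  by apply: polyfun_ext (polyfun_cst T 1) => x; rewrite big_nil.
case Pi: (P i); last by apply: polyfun_ext IH => x; rewrite big_cons Pi.
by apply: polyfun_ext (polyfunM (pP _ Pi) IH) => x; rewrite big_cons Pi.
Qed.

Lemma polyfunX (T : Type) (p : (T -> F) -> F) n : polyfun p -> polyfun (fun x => p x ^+ n).
Proof.
move=> pp; elim: n => [|n IH]; first by apply: polyfun_ext (polyfun_cst T 1) => x; rewrite expr0.
by apply: polyfun_ext (polyfunM pp IH) => x; rewrite exprS.
Qed.

Lemma polyfun_comp (T U : Type) (s : T -> (U -> F) -> F) (p : (T -> F) -> F) :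
  (forall i, polyfun (s i)) -> polyfun p -> polyfun (fun y => p (s^~ y)).
Proof.
move=> sP; elim=> [c|i|p1 p2 _ IH1 _ IH2|p1 p2 _ IH1 _ IH2] //=.
- exact: polyfun_cst.
- exact: polyfunD.
- exact: polyfunM.
Qed.

Lemma polyfun_curve (T : Type) (p : (T -> F) -> F) (l : T -> {poly F}) :
  polyfun p -> exists P : {poly F}, forall t, p (fun i => (l i).[t]) = P.[t].
Proof.
elim=> [c|i|p1 p2 _ [P1 E1] _ [P2 E2]|p1 p2 _ [P1 E1] _ [P2 E2]].
- by exists c%:P => t; rewrite hornerC.
- by exists (l i).
- by exists (P1 + P2) => t; rewrite hornerD E1 E2.
- by exists (P1 * P2) => t; rewrite hornerM E1 E2.
Qed.

End Polyfun.

Section Monomials.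
Variables (F : comNzRingType) (T : finType).
Implicit Types (x : T -> F) (p q : (T -> F) -> F).

Definition mono (al : T -> nat) x : F := \prod_i x i ^+ al i.

Lemma monoD al be x : mono (fun i => al i + be i)%N x = mono al x * mono be x.
Proof. by rewrite /mono -big_split /=; apply: eq_bigr => i _; rewrite exprD. Qed.

Lemma mono0 x : mono (fun _ => 0%N) x = 1.
Proof. by rewrite /mono big1. Qed.

Lemma mono1 i x : mono (fun j => (j == i) : nat) x = x i.
Proof.
rewrite /mono (bigD1 i) //= eqxx expr1 big1 ?mulr1 // => j /negbTE->.
by rewrite expr0.
Qed.

Lemma polyfun_mono al : polyfun (mono al).
Proof. by apply: polyfun_prod => i _; apply/polyfunX/polyfun_coord. Qed.

(** Each exponent is bounded separately, so that the monomials form a finite type with exactly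
    $(D+1)^{|T|}$ elements. *)
Definition boxpoly D p := exists c : {ffun T -> 'I_D.+1} -> F,
  forall x, p x = \sum_al c al * mono (fun i => al i) x.

Lemma boxpoly_ext D p q : p =1 q -> boxpoly D p -> boxpoly D q.
Proof. by move=> /funext->. Qed.

Lemma boxpoly_mono D (c : F) al : (forall i, al i <= D)%N -> boxpoly D (fun x => c * mono al x).
Proof.
move=> alD; exists (fun be => if be == [ffun i => inord (al i)] then c else 0) => x.
rewrite (bigD1 [ffun i => inord (al i)]) //= eqxx big1 ?addr0; last first.
  by move=> be /negbTE->; rewrite mul0r.
by congr (_ * _); apply: eq_bigr => i _; rewrite ffunE inordK // ltnS alD.
Qed.

Lemma boxpolyD D p q : boxpoly D p -> boxpoly D q -> boxpoly D (fun x => p x + q x).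
Proof.
move=> [c E] [d E']; exists (fun al => c al + d al) => x; rewrite E E' -big_split /=.
by apply: eq_bigr => al _; rewrite mulrDl.
Qed.

Lemma boxpoly_sum D (I : finType) (p : I -> (T -> F) -> F) :
  (forall i, boxpoly D (p i)) -> boxpoly D (fun x => \sum_i p i x).
Proof.
move=> pP; elim: (index_enum I) => [|i r IH].
  exists (fun _ => 0) => x; rewrite big_nil big1 // => al _; by rewrite mul0r.
by apply: boxpoly_ext (boxpolyD (pP i) IH) => x; rewrite big_cons.
Qed.

Lemma boxpolyM D E p q : boxpoly D p -> boxpoly E q -> boxpoly (D + E) (fun x => p x * q x).
Proof.
move=> [c pE] [d qE].
have := @boxpoly_sum (D + E) _ (fun u x => (c u.1 * d u.2) *
  mono (fun i => (u.1 : {ffun T -> 'I_D.+1}) i + (u.2 : {ffun T -> 'I_E.+1}) i)%N x).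
move=> H; apply: boxpoly_ext (H _) => [x|[al be]]; last first.
  by apply: boxpoly_mono => i /=; rewrite leq_add // -ltnS.
rewrite pE qE big_distrlr pair_big /=; apply: eq_bigr => -[al be] _ /=.
by rewrite monoD mulrACA.
Qed.

Lemma boxpolyW D E p : (D <= E)%N -> boxpoly D p -> boxpoly E p.
Proof.
move=> DE [c pE]; have := @boxpoly_sum E _ (fun u x => c u * mono (fun i => u i) x).
move=> H; apply: boxpoly_ext (H _) => [x|u]; first by rewrite pE.
by apply: boxpoly_mono => i; rewrite (leq_trans _ DE) // -ltnS.
Qed.

Lemma boxpolyX D p n : boxpoly D p -> boxpoly (D * n) (fun x => p x ^+ n).
Proof.
move=> pD; elim: n => [|n IH].
  rewrite muln0; apply: boxpoly_ext (@boxpoly_mono 0 1 (fun _ => 0%N) _) => // x.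
  by rewrite mono0 mulr1 expr0.
by rewrite mulnS; apply: boxpoly_ext (boxpolyM pD IH) => x; rewrite exprS.
Qed.

Lemma boxpoly_prod (I : finType) (D : I -> nat) (p : I -> (T -> F) -> F) :
  (forall i, boxpoly (D i) (p i)) -> boxpoly (\sum_i D i) (fun x => \prod_i p i x).
Proof.
move=> pP; elim: (index_enum I) => [|i r IH].
  rewrite big_nil; apply: boxpoly_ext (@boxpoly_mono 0 1 (fun _ => 0%N) _) => // x.
  by rewrite mono0 mulr1 big_nil.
by rewrite big_cons; apply: boxpoly_ext (boxpolyM (pP i) IH) => x; rewrite big_cons.
Qed.

Lemma polyfun_boxpoly p : polyfun p -> exists D, boxpoly D p.
Proof.
elim=> [c|i|p1 p2 _ [D1 E1] _ [D2 E2]|p1 p2 _ [D1 E1] _ [D2 E2]].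
- exists 0%N; apply: boxpoly_ext (@boxpoly_mono 0 c (fun _ => 0%N) _) => // x.
  by rewrite mono0 mulr1.
- exists 1%N; apply: boxpoly_ext (@boxpoly_mono 1 1 (fun j => (j == i) : nat) _) => [x|j].
    by rewrite mono1 mul1r.
  exact: leq_b1.
- exists (D1 + D2)%N; apply: boxpolyD; first by apply: boxpolyW E1; rewrite leq_addr.
  by apply: boxpolyW E2; rewrite leq_addl.
- by exists (D1 + D2)%N; apply: boxpolyM.
Qed.

End Monomials.

(* The exponents of Kronecker's substitution. *)
Lemma digits_inj (T : finType) D :
  injective (fun al : {ffun T -> 'I_D.+1} => \sum_i al i * D.+1 ^ enum_rank i)%N.
Proof.
have key n : injective (fun al : {ffun 'I_n -> 'I_D.+1} => \sum_(i < n) al i * D.+1 ^ i)%N.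
  elim: n => [|n IH] al be /=; first by move=> _; apply/ffunP => -[].
  rewrite !big_ord_recl /= !expn0 !muln1.
  have tl (g : {ffun 'I_n.+1 -> 'I_D.+1}) :
      (\sum_(i < n) g (lift ord0 i) * D.+1 ^ bump 0 i =
       (\sum_(i < n) [ffun i => g (lift ord0 i)] i * D.+1 ^ i) * D.+1)%N.
    by rewrite big_distrl /=; apply: eq_bigr => i _; rewrite ffunE /bump add1n expnSr mulnA.
  rewrite !tl => E.
  have E0 : al ord0 = be ord0.
    by apply: val_inj; have := congr1 (modn^~ D.+1) E; rewrite /= ![(_ + _ * _)%N]addnC !modnMDl !modn_small.
  have /IH/ffunP E1 : (\sum_(i < n) [ffun i => al (lift ord0 i)] i * D.+1 ^ i =
    \sum_(i < n) [ffun i => be (lift ord0 i)] i * D.+1 ^ i)%N.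
    move: E; rewrite E0 => /addnI/eqP; rewrite eqn_pmul2r // => /eqP; exact.
  apply/ffunP => i; case: (unliftP ord0 i) => [j|] -> //.
  by have := E1 j; rewrite !ffunE.
move=> al be /= E.
have /key/ffunP H : (\sum_(i < #|T|) [ffun i => al (enum_val i)] i * D.+1 ^ i =
  \sum_(i < #|T|) [ffun i => be (enum_val i)] i * D.+1 ^ i)%N.
  rewrite !(reindex (enum_rank : T -> _)) /=; last by exists enum_val => i _; rewrite ?enum_rankK ?enum_valK.
    by under eq_bigr do rewrite ffunE enum_rankK; rewrite E; under [RHS]eq_bigr do rewrite ffunE enum_rankK.
  by exists enum_val => i _; rewrite ?enum_rankK ?enum_valK.
by apply/ffunP => i; have := H (enum_rank i); rewrite !ffunE enum_rankK.
Qed.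

Section InfiniteField.
Variable F : numFieldType.

Lemma poly_eval_eq0 (p : {poly F}) : (forall t, p.[t] = 0) -> p = 0.
Proof.
move=> p0; apply/eqP/negP => /negP pn0.
have := @max_poly_roots F p (mkseq (fun i => i%:R) (size p)) pn0.
rewrite size_mkseq ltnn => H; suff: false by []; apply: H.
  by apply/allP => x _; rewrite /root p0.
by apply: mkseq_uniq => i j /eqP; rewrite eqr_nat => /eqP.
Qed.

(** Kronecker's substitution $x_i = t^{(D+1)^i}$ sends distinct monomials to distinct powers of
    $t$. *)
Lemma mono_free (T : finType) D (c : {ffun T -> 'I_D.+1} -> F) :
  (forall x, \sum_al c al * mono (fun i => al i) x = 0) -> forall al, c al = 0.
Proof.
move=> c0 al.
pose e (be : {ffun T -> 'I_D.+1}) := (\sum_i be i * D.+1 ^ enum_rank i)%N.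
have : \sum_be c be *: 'X^(e be) = 0 :> {poly F}.
  apply: poly_eval_eq0 => t; rewrite horner_sum -[RHS](c0 (fun i => t ^+ (D.+1 ^ enum_rank i))).
  apply: eq_bigr => be _; rewrite hornerZ hornerXn; congr (_ * _).
  by rewrite /mono /e expr_sum; apply: eq_bigr => i _; rewrite -exprM mulnC.
move=> /(congr1 (fun p : {poly F} => p`_(e al))); rewrite coef_sum coef0.
rewrite (bigD1 al) //= big1 => [|be neq]; first by rewrite coefZ coefXn eqxx mulr1 addr0.
by rewrite coefZ coefXn (inj_eq (@digits_inj T D)) eq_sym (negbTE neq) mulr0.
Qed.

(** Along the line joining a nonzero of [p] to a nonzero of [q], both become nonzero polynomials in
    one variable. *)
Lemma polyfunM_neq0 (T : Type) (p q : (T -> F) -> F) : polyfun p -> polyfun q ->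
  (exists x, p x != 0) -> (exists x, q x != 0) -> exists x, p x * q x != 0.
Proof.
move=> pp qp [x px] [y qy].
pose l i : {poly F} := (x i)%:P + (y i - x i) *: 'X.
have lE t : (fun i => (l i).[t]) = (fun i => x i + (y i - x i) * t).
  by apply/funext => i; rewrite /l hornerD hornerC hornerZ hornerX.
have [P PE] := polyfun_curve l pp; have [S SE] := polyfun_curve l qp.
have l0 : (fun i => (l i).[0]) = x by rewrite lE; apply/funext => i; rewrite mulr0 addr0.
have l1 : (fun i => (l i).[1]) = y by rewrite lE; apply/funext => i; rewrite mulr1 addrC subrK.
have Pn0 : P != 0 by apply: contraNneq px => P0; rewrite -l0 PE P0 horner0.
have Sn0 : S != 0 by apply: contraNneq qy => S0; rewrite -l1 SE S0 horner0.
have /eqP PS : P * S != 0 by rewrite mulf_neq0.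
apply: contrapT => H; apply: PS; apply: poly_eval_eq0 => t.
apply/eqP/negP => /negP nz; apply: H; exists (fun i => (l i).[t]).
by rewrite PE SE -hornerM.
Qed.

End InfiniteField.

(** * Common zeros of polynomial functions *)

(** Used to compare numbers of monomials: $m$ free exponents eventually outnumber $k < m$ of them,
    even after rescaling the bound by $n$. *)
Lemma expn_dominates C n k m : (k < m)%N ->
  exists L, (C * (n * L.+1) ^ k < L.+1 ^ m)%N.
Proof.
move=> km; exists (C * n ^ k)%N; set L := (C * n ^ k)%N.
rewrite expnMn mulnA -/L (@leq_trans (L.+1 ^ k.+1)) //; last by rewrite leq_pexp2l.
by rewrite expnS ltn_pmul2r ?expn_gt0.
Qed.

(** * Linear spans of functions *)

Section Lin.
Variables (F : fieldType) (X : Type).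
Implicit Types (S : (X -> F) -> Prop).

Inductive lin S : (X -> F) -> Prop :=
| lin0 : lin S (fun _ => 0)
| linZD c s f : S s -> lin S f -> lin S (fun x => c * s x + f x).

Lemma lin_ext S f g : f =1 g -> lin S f -> lin S g.
Proof. by move=> /funext->. Qed.

Lemma linD S f g : lin S f -> lin S g -> lin S (fun x => f x + g x).
Proof.
move=> lf lg; elim: lf => [|c s f' Ss _ IH].
  by apply: lin_ext lg => x; rewrite add0r.
by apply: lin_ext (linZD c Ss IH) => x; rewrite addrA.
Qed.

Lemma linZ S c f : lin S f -> lin S (fun x => c * f x).
Proof.
elim=> [|d s f' Ss _ IH]; first by apply: lin_ext (lin0 S) => x; rewrite mulr0.
by apply: lin_ext (linZD (c * d) Ss IH) => x; rewrite mulrDr mulrA.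
Qed.

Lemma lin_gen S s : S s -> lin S s.
Proof. by move=> Ss; apply: lin_ext (linZD 1 Ss (lin0 S)) => x; rewrite mul1r addr0. Qed.

Lemma lin_sum S (I : Type) (r : seq I) (f : I -> X -> F) :
  (forall i, lin S (f i)) -> lin S (fun x => \sum_(i <- r) f i x).
Proof.
move=> lf; elim: r => [|i r IH]; first by apply: lin_ext (lin0 S) => x; rewrite big_nil.
by apply: lin_ext (linD (lf i) IH) => x; rewrite big_cons.
Qed.

Lemma lin_mul S S' f g : (forall s, S s -> lin S' (fun x => s x * g x)) ->
  lin S f -> lin S' (fun x => f x * g x).
Proof.
move=> SS'; elim=> [|c s f' Ss _ IH]; first by apply: lin_ext (lin0 S') => x; rewrite mul0r.
by apply: lin_ext (linD (linZ c (SS' _ Ss)) IH) => x; rewrite mulrDl mulrA.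
Qed.

Lemma lin_sub S S' f : (forall s, S s -> lin S' s) -> lin S f -> lin S' f.
Proof.
move=> SS' lf; apply: lin_ext (lin_mul (g := fun _ => 1) _ lf) => [x|s Ss]; first by rewrite mulr1.
by apply: lin_ext (SS' _ Ss) => x; rewrite mulr1.
Qed.

Lemma lin_finite (U : finType) (u : U -> X -> F) f :
  lin (fun s => exists j, s = u j) f -> exists b : U -> F, forall x, f x = \sum_j b j * u j x.
Proof.
elim=> [|c s f' [j ->] _ [b fE]].
  by exists (fun _ => 0) => x; rewrite big1 // => j _; rewrite mul0r.
exists (fun k => (if k == j then c else 0) + b k) => x.
under eq_bigr do rewrite mulrDl; rewrite big_split -fE /=; congr (_ + _).
by rewrite (bigD1 j) //= eqxx big1 ?addr0 // => k /negbTE->; rewrite mul0r.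
Qed.
End Lin.

(** * Weak Nullstellensatz over an uncountable algebraically closed field *)

Section Nullstellensatz.
Variables (F : numClosedFieldType) (T : finType).
Hypothesis uncF : ~ countable [set: F].
Local Notation fn := ((T -> F) -> F).

Definition polyideal (J : fn -> Prop) :=
  [/\ forall p, J p -> polyfun p, J (fun _ => 0),
      forall p q, J p -> J q -> J (fun x => p x + q x) &
      forall p q, polyfun p -> J q -> J (fun x => p x * q x)].

Lemma polyideal_ext J (p q : fn) : p =1 q -> J p -> J q.
Proof. by move=> /funext->. Qed.

Lemma polyideal_sum J (I : Type) (r : seq I) (p : I -> fn) : polyideal J ->
  (forall i, J (p i)) -> J (fun x => \sum_(i <- r) p i x).
Proof.
move=> [_ J0 JD _] Jp; elim: r => [|i r IH].
  by apply: polyideal_ext J0 => x; rewrite big_nil.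
by apply: polyideal_ext (JD _ _ (Jp i) IH) => x; rewrite big_cons.
Qed.

Definition adjoin (J : fn -> Prop) (g : fn) (p : fn) :=
  exists q r : fn, [/\ J q, polyfun r & p = fun x => q x + r x * g x].

Lemma polyideal_adjoin J g : polyfun g -> polyideal J -> polyideal (adjoin J g).
Proof.
move=> pg [Jp J0 JD JM]; split.
- move=> _ [q [r [Jq pr ->]]]; apply: polyfunD; [exact: Jp|exact: polyfunM].
- exists (fun _ => 0), (fun _ => 0); split => //; first exact: polyfun_cst.
  by apply/funext => x; rewrite mul0r addr0.
- move=> _ _ [q [r [Jq pr ->]]] [q' [r' [Jq' pr' ->]]].
  exists (fun x => q x + q' x), (fun x => r x + r' x); split; [exact: JD|exact: polyfunD|].
  by apply/funext => x; rewrite mulrDl addrACA.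
- move=> p _ pp [q [r [Jq pr ->]]].
  exists (fun x => p x * q x), (fun x => p x * r x); split; [exact: JM|exact: polyfunM|].
  by apply/funext => x; rewrite mulrDr mulrA.
Qed.

(** A union of countably many finite fibres would be countable, so some fibre is infinite. *)
Lemma uncountable_fiber (d : F -> nat) : exists n, forall N, exists2 s : seq F,
  uniq s && (size s == N) & forall a, a \in s -> d a = n.
Proof.
have [n nfin] : exists n, infinite_set [set a | d a = n]%classic.
  apply: contrapT => H; apply: uncF.
  have -> : [set: F]%classic = (\bigcup_(n in [set: nat]) [set a | d a = n])%classic.
    by apply/seteqP; split => // a _; exists (d a).
  apply: bigcup_countable => // n _; apply: finite_set_countable.
  by apply: contrapT => nfin; apply: H; exists n.
exists n => N; have [D Dsub DN] := infinite_set_fset N nfin.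
exists (take N (finmap.enum_fset D)); last by move=> a /mem_take aD; apply: Dsub.
by rewrite take_uniq ?finmap.fset_uniq //= size_takel.
Qed.

(* Dixmier's argument: if g - a were invertible modulo J for every scalar a, then
   uncountably many inverses would be linearly dependent, because polynomials span a
   space of countable dimension; this forces some polynomial in g into J. *)
Lemma exists_adjoin_proper J (g : fn) : polyideal J -> ~ J (fun _ => 1) -> polyfun g ->
  exists a, ~ adjoin J (fun x => g x - a) (fun _ => 1).
Proof.
move=> Ji J1 pg; apply: contrapT => H.
have [Jp J0 JD JM] := Ji.
have pga a : polyfun (fun x => g x - a) by apply: polyfunD => //; apply: polyfun_cst.
have inv a : exists u : fn * fn * nat, [/\ J u.1.1, polyfun u.1.2, boxpoly u.2 u.1.2 &
    forall x, u.1.1 x + u.1.2 x * (g x - a) = 1].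
  have [q [r [Jq pr E]]] : adjoin J (fun x => g x - a) (fun _ => 1).
    by apply: contrapT => na; apply: H; exists a.
  have [D bD] := polyfun_boxpoly pr; exists (q, r, D); split => // x.
  by rewrite -(congr1 (fun f => f x) E).
have [u uP] := choice inv.
(* Every [g - z] is invertible modulo [J], so the factors can be cancelled one at a time. *)
have JNprod (r : seq F) : J (fun x => \prod_(z <- r) (g x - z)) -> J (fun _ => 1).
  elim: r => [|z r IH] Jr; first by apply: polyideal_ext Jr => x; rewrite big_nil.
  apply: IH; have [Jq pr _ E] := uP z.
  have ph : polyfun (fun x => \prod_(z <- r) (g x - z)) by apply: polyfun_prod => i _.
  apply: polyideal_ext (JD _ _ (JM _ _ pr Jr) (JM _ _ ph Jq)) => x.
  by rewrite big_cons /= mulrA [X in _ + X]mulrC -mulrDl addrC E mul1r.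
have [n nP] := uncountable_fiber (fun a => (u a).2).
have [s /andP[us /eqP ss] sP] := nP #|{ffun T -> 'I_n.+1}|.+1.
have [||c [i0 ci0] cE] := @dep_of_span F _ 'I_(size s) {ffun T -> 'I_n.+1}
    (fun i => (u s`_i).1.2) (fun al x => mono (fun i => al i) x).
- by move=> i; have [_ _] := uP s`_i; rewrite sP ?mem_nth.
- by rewrite card_ord ss.
(* The numerator of $\sum_i c_i/(t - s_i)$: it is nonzero at $s_{i_0}$, and the relation between the
   inverses puts [P] evaluated at [g] into [J]. *)
pose P : {poly F} := \sum_(i < size s) c i *: \prod_(l < size s | l != i) ('X - (s`_l)%:P).
have PE t : P.[t] = \sum_(i < size s) c i * \prod_(l < size s | l != i) (t - s`_l).
  rewrite horner_sum; apply: eq_bigr => i _; rewrite hornerZ horner_prod; congr (_ * _).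
  by apply: eq_bigr => l _; rewrite hornerXsubC.
have Pn0 : P != 0.
  suff: P.[s`_i0] != 0 by apply: contraNneq => ->; rewrite horner0.
  rewrite PE (bigD1 i0) //= [X in _ + X]big1 ?addr0 => [|i ni].
    rewrite mulf_neq0 //; apply/prodf_neq0 => l nl; rewrite subr_eq0.
    by rewrite nth_uniq // eq_sym.
  by rewrite (bigD1 i0) 1?eq_sym //= subrr mul0r mulr0.
have JP : J (fun x => P.[g x]).
  have JPi i : J (fun x => c i * \prod_(l < size s | l != i) (g x - s`_l) * (u s`_i).1.1 x).
    apply: JM; last by have [] := uP s`_i.
    by apply: polyfunM; [exact: polyfun_cst|exact: polyfun_prod].
  apply: polyideal_ext (polyideal_sum (index_enum 'I_(size s)) Ji JPi) => x; rewrite PE.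
  rewrite -[LHS]addr0 -[X in _ + X](mulr0 (\prod_(l < size s) (g x - s`_l))) -[X in _ + _ * X](cE x).
  rewrite mulr_sumr -big_split /=; apply: eq_bigr => i _.
  have [_ _ _ /(_ x) E] := uP s`_i.
  have -> : \prod_(l < size s) (g x - s`_l) =
      (g x - s`_i) * \prod_(l < size s | l != i) (g x - s`_l) by rewrite (bigD1 i).
  by rewrite -[RHS]mulr1 -E; ring.
have [r rE] := closed_field_poly_normal P.
apply/J1/(JNprod r); apply: polyideal_ext (JM _ _ (polyfun_cst _ (lead_coef P)^-1) JP) => x.
rewrite [in X in _ * X]rE hornerZ mulKf ?lead_coef_eq0 // horner_prod.
by apply: eq_bigr => z _; rewrite hornerXsubC.
Qed.

(** Adjoining $x_i - a_i$ for one coordinate after another keeps the ideal proper. In the end every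
    [p] is congruent to the constant [p a], which must vanish for [p] in the ideal. *)
Lemma nullstellensatz J : polyideal J -> ~ J (fun _ => 1) ->
  exists a : T -> F, forall p, J p -> p a = 0.
Proof.
move=> Ji J1.
have [J' [[Jp J0 JD JM] J'1 JJ' [a aP]]] : exists J' : fn -> Prop,
    [/\ polyideal J', ~ J' (fun _ => 1), forall p, J p -> J' p &
        exists a : T -> F, forall i, i \in enum T -> J' (fun x => x i - a i)].
  elim: (enum T) => [|i s [J' [Ji' J'1 JJ' [a aP]]]].
    by exists J; split => //; exists (fun _ => 0).
  have [b b1] := exists_adjoin_proper Ji' J'1 (polyfun_coord F i).
  have pb : polyfun (fun x : T -> F => x i - b) by apply: polyfunD; [exact: polyfun_coord|exact: polyfun_cst].
  exists (adjoin J' (fun x => x i - b)); split=> //.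
  - exact: polyideal_adjoin.
  - move=> p /JJ' Jp; exists p, (fun _ => 0); split => //; first exact: polyfun_cst.
    by apply/funext => x; rewrite mul0r addr0.
  exists (fun j => if j == i then b else a j) => j; rewrite inE; case: eqP => [-> _|_ /= /aP Jj].
    exists (fun _ => 0), (fun _ => 1); split; [by case: Ji'|exact: polyfun_cst|].
    by apply/funext => x; rewrite mul1r add0r.
  exists (fun x => x j - a j), (fun _ => 0); split => //; first exact: polyfun_cst.
  by apply/funext => x; rewrite mul0r addr0.
have key p : polyfun p -> J' (fun x => p x - p a).
  elim=> [c|i|p1 p2 pp1 IH1 pp2 IH2|p1 p2 pp1 IH1 pp2 IH2].
  - by apply: polyideal_ext J0 => x; rewrite subrr.
  - by apply: aP; rewrite mem_enum.
  - by apply: polyideal_ext (JD _ _ IH1 IH2) => x; rewrite opprD addrACA.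
  - apply: polyideal_ext (JD _ _ (JM _ _ pp2 IH1) (JM _ _ (polyfun_cst _ (p1 a)) IH2)) => x.
    by ring.
exists a => p Jp0; apply: contrapT => /eqP pa; apply: J'1.
have pp : polyfun p by apply/Jp/JJ'.
have JC : J' (fun _ => p a).
  apply: polyideal_ext (JD _ _ (JJ' _ Jp0) (JM _ _ (polyfun_cst _ (-1)) (key _ pp))) => x.
  by rewrite mulN1r subKr.
by apply: polyideal_ext (JM _ _ (polyfun_cst _ (p a)^-1) JC) => x; rewrite mulVf.
Qed.

End Nullstellensatz.

(** * Nontrivial zeros of underdetermined homogeneous systems *)

Section HomogeneousZero.
Variables (F : numClosedFieldType) (X J : finType).
Hypothesis uncF : ~ countable [set: F].
Variables (E : J -> (X -> F) -> F) (e : J -> nat).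
Hypothesis polyE : forall j, polyfun (E j).
Hypothesis e_gt0 : forall j, (0 < e j)%N.
Hypothesis homE : forall j s y, E j (fun a => s * y a) = s ^+ e j * E j y.

Lemma mono_scale (al : X -> nat) (s : F) y :
  mono al (fun a => s * y a) = s ^+ (\sum_a al a) * mono al y.
Proof. by rewrite /mono expr_sum -big_split /=; apply: eq_bigr => a _; rewrite exprMn. Qed.

(** The Nullstellensatz is applied to the [E j] together with $y_a - 1$. If these generate 1,
    substituting $y/y_a$ and multiplying by $y_a^N$ homogenises the identity. *)
Lemma affine_chart_zero (a : X) :
  (exists2 y, y a != 0 & forall j, E j y = 0) \/
  exists N, lin (fun s => exists j (de : X -> nat), (\sum_b de b < N)%N /\
    s = fun y => E j y * mono de y) (fun y => y a ^+ N).
Proof.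
pose J0 (p : (X -> F) -> F) := exists (g : J -> (X -> F) -> F) (h : (X -> F) -> F),
  [/\ forall j, polyfun (g j), polyfun h &
      p = fun y => \sum_j g j y * E j y + h y * (y a - 1)].
have J0i : polyideal J0.
  split.
  - move=> _ [g [h [pg ph ->]]]; apply: polyfunD.
      by apply: polyfun_sum => j _; apply: polyfunM.
    by apply: polyfunM => //; apply: polyfunD; [exact: polyfun_coord|exact: polyfun_cst].
  - exists (fun _ _ => 0), (fun _ => 0); split => [j||]; try exact: polyfun_cst.
    by apply/funext => y; rewrite mul0r addr0 big1 // => j _; rewrite mul0r.
  - move=> _ _ [g [h [pg ph ->]]] [g' [h' [pg' ph' ->]]].
    exists (fun j y => g j y + g' j y), (fun y => h y + h' y); split => [j||]; try exact: polyfunD.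
    apply/funext => y; rewrite mulrDl addrACA -big_split /=; congr (_ + _).
    by apply: eq_bigr => j _; rewrite mulrDl.
  - move=> p _ pp [g [h [pg ph ->]]].
    exists (fun j y => p y * g j y), (fun y => p y * h y); split => [j||]; try exact: polyfunM.
    by apply/funext => y; rewrite mulrDr mulr_sumr mulrA; congr (_ + _); apply: eq_bigr => j _; rewrite mulrA.
have [[g [h [pg ph E1]]]|n1] := pselect (J0 (fun _ => 1)); [right|left]; last first.
  have [y yP] := nullstellensatz uncF J0i n1; exists y => [|j].
    have /eqP : y a - 1 = 0.
      apply: (yP (fun x => x a - 1)); exists (fun _ _ => 0), (fun _ => 1).
      split => [j||]; try exact: polyfun_cst.
      by apply/funext => x; rewrite mul1r big1 ?add0r // => j _; rewrite mul0r.
    by rewrite subr_eq0 => /eqP->; rewrite oner_neq0.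
  apply: yP; exists (fun k _ => (k == j)%:R), (fun _ => 0).
  split => [k||]; try exact: polyfun_cst.
  apply/funext => x; rewrite mul0r addr0 (bigD1 j) //= eqxx mul1r big1 ?addr0 // => k /negbTE->.
  by rewrite mul0r.
have [D0 D0P] := choice (fun j => polyfun_boxpoly (pg j)).
pose D := \max_j D0 j.
have [c cP] := choice (fun j => boxpolyW (leq_bigmax j) (D0P j)).
(* [N] strictly exceeds every degree that occurs, so a positive power of $y_a$ is left in each term;
   this settles the case $y_a = 0$ as well. *)
pose N := (\sum_j (e j + #|X| * D)).+1.
have {}cP j : forall y, g j y = \sum_ga c j ga * mono (fun b => (ga : {ffun X -> 'I_D.+1}) b) y := cP j.
have NP j (ga : {ffun X -> 'I_D.+1}) : (e j + \sum_b ga b < N)%N.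
  rewrite ltnS (bigD1 j) //= (leq_trans _ (leq_addr _ _)) // leq_add2l.
  by rewrite -sum_nat_const leq_sum // => b _; rewrite -ltnS.
pose de j (ga : {ffun X -> 'I_D.+1}) (b : X) : nat :=
  (ga b + (b == a) * (N - (e j + \sum_b ga b)))%N.
have deE j ga y : mono (de j ga) y = mono (fun b => ga b) y * y a ^+ (N - (e j + \sum_b ga b)).
  rewrite monoD; congr (_ * _); move: (N - _)%N => M; rewrite /mono (bigD1 a) //= eqxx mul1n big1 ?mulr1 // => b /negbTE->.
  by rewrite mul0n expr0.
exists N; apply: lin_ext (lin_sum (index_enum J)
   (f := fun j y => \sum_ga c j ga * (E j y * mono (de j ga) y)) _) => [y|j]; last first.
  apply: lin_sum => ga; apply: linZ; apply: lin_gen; exists j, (de j ga); split=> //.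
  rewrite /de big_split /=; have := NP j ga; have := e_gt0 j.
  move: (\sum_i ga i)%N => G; move=> ej GM.
  rewrite (bigD1 a) //= eqxx mul1n big1 => [|b /negbTE->]; last by rewrite mul0n.
  move: (N) ej GM => M; lia.
have [y0|yn0] := eqVneq (y a) 0.
  rewrite y0 expr0n /= big1 // => j _; rewrite big1 // => ga _.
  by rewrite deE y0 expr0n subn_eq0 leqNgt NP /= !mulr0.
pose y' b := (y a)^-1 * y b.
have := congr1 (fun p => y a ^+ N * p y') E1.
have -> : y' a = 1 by rewrite /y' mulVf.
rewrite mulr1 subrr mulr0 addr0 mulr_sumr => ->.
apply: eq_bigr => j _; rewrite cP homE mulr_suml mulr_sumr; apply: eq_bigr => ga _.
rewrite deE mono_scale expfB ?NP // exprD.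
rewrite !exprVn; field.
by rewrite !expf_neq0.
Qed.

(* Without a common zero outside the origin, every coordinate has a power in the ideal of
   the E j, so the monomials in the E j times finitely many monomials span all
   polynomials; for |J| < |X| there are too few of them in large degree. *)
Theorem homogeneous_common_zero : (#|J| < #|X|)%N ->
  exists2 y, exists a, y a != 0 & forall j, E j y = 0.
Proof.
move=> JX; apply: contrapT => nz.
have chart a : exists N, lin (fun s => exists j (de : X -> nat), (\sum_b de b < N)%N /\
    s = fun y => E j y * mono de y) (fun y => y a ^+ N).
  have [[y ya yE]|//] := affine_chart_zero a.
  by case: nz; exists y => //; exists a.
have {chart}[Na NaP] := choice chart.
pose N := \max_a Na a.
(* Monomials in the [E j] with exponents at most [k], times monomials from a finite set independent
   of [k]. *)
pose S k (s : (X -> F) -> F) := exists (be : J -> nat) (al : X -> nat),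
  [/\ forall j, (be j <= k)%N, forall a, (al a <= N)%N &
      s = fun y => mono be (fun j => E j y) * mono al y].
have SS k s : S k s -> S k.+1 s.
  by move=> [be [al [bek alN ->]]]; exists be, al; split => // j; rewrite ltnW // ltnS.
have SE k j s : S k s -> S k.+1 (fun y => s y * E j y).
  move=> [be [al [bek alN ->]]]; exists (fun i => be i + (i == j))%N, al; split => // [i|].
    by have := bek i; case: (i == j); lia.
  by apply/funext => y; rewrite monoD mono1 mulrAC.
have key k (al : X -> nat) : (\sum_a al a <= k)%N -> lin (S k) (mono al).
  elim: k al => [|k IH] al alk.
    apply: lin_gen; exists (fun _ => 0%N), al; split => // [a|].
      by move: alk; rewrite leqn0 sum_nat_eq0 => /forallP/(_ a)/eqP->.
    by apply/funext => y; rewrite mono0 mul1r.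
  have [alN|/existsP[a Na_al]] := boolP [forall a, al a <= N]%N.
    apply: lin_gen; exists (fun _ => 0%N), al; split => //; first exact/forallP.
    by apply/funext => y; rewrite mono0 mul1r.
  move: Na_al; rewrite -ltnNge => Na_al.
  have Na_le : (Na a <= al a)%N by rewrite (leq_trans (leq_bigmax a)) // ltnW.
  pose al' b := (al b - (b == a) * Na a)%N.
  have alE b : al b = (al' b + (b == a) * Na a)%N.
    by rewrite /al' subnK //; case: eqP => [->|_]; rewrite ?mul1n.
  have sal' : (\sum_b al' b + Na a <= k.+1)%N.
    rewrite (leq_trans _ alk) // (eq_bigr _ (fun b _ => alE b)) big_split /= leq_add2l.
    by rewrite (bigD1 a) //= eqxx mul1n leq_addr.
  (* The factor $y_a^{N_a}$ is traded for combinations of some [E j] times a monomial of smaller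
     degree, to which the induction hypothesis applies. *)
  apply: lin_ext (lin_mul (g := mono al') _ (NaP a)) => [y|_ [j [de [deN ->]]]].
    rewrite (_ : mono al y = mono al' y * mono (fun b => (b == a) * Na a)%N y); last first.
      by rewrite -monoD; apply: eq_bigr => b _; rewrite alE.
    rewrite mulrC; congr (_ * _); rewrite /mono (bigD1 a) //= eqxx mul1n big1 ?mulr1 // => b /negbTE->.
    by rewrite mul0n expr0.
  have := IH (fun b => de b + al' b)%N; rewrite big_split /= => /(_ _) IH'.
  apply: lin_ext (lin_mul (g := E j) _ (IH' _)) => [y|s Ss|]; last by lia.
    by rewrite monoD; ring.
  by apply: lin_gen; apply: SE.
pose n := #|X|.
(* Monomials with exponents at most [L] have degree at most [n * L]; for this [L] they outnumber the
   generators of [S (n * L)]. *)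
have [L LP] := expn_dominates (N.+1 ^ n) n JX.
have [||c [al0 c0] cE] := @dep_of_span F (X -> F) {ffun X -> 'I_L.+1}
    ({ffun J -> 'I_(n * L).+1} * {ffun X -> 'I_N.+1})%type (fun al => mono (fun i => al i))
    (fun u y => mono (fun j => u.1 j) (fun j => E j y) * mono (fun i => u.2 i) y).
- move=> al; apply: lin_finite; apply: lin_sub (key (n * L)%N _ _) => [s [be [ga [beP gaP ->]]]|].
    apply: lin_gen; exists ([ffun j => inord (be j)], [ffun i => inord (ga i)]).
    apply/funext => y /=; congr (_ * _); apply: eq_bigr => i _; rewrite ffunE inordK ?ltnS //.
  by rewrite -sum_nat_const leq_sum // => i _; rewrite -ltnS.
- rewrite card_prod !card_ffun !card_ord mulnC (leq_ltn_trans _ LP) // leq_mul2l; apply/orP; right.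
  have nL : ((n * L).+1 <= n * L.+1)%N by rewrite mulnS -add1n leq_add2r; apply: leq_ltn_trans JX.
  by elim: #|J| => // i IH; rewrite !expnS leq_mul.
by move: c0; rewrite (mono_free cE) eqxx.
Qed.
End HomogeneousZero.

(** * Coefficients with a nontrivial critical point *)

Lemma big_sig_val (R : Type) (idx : R) (op : Monoid.com_law idx) (I : finType) (P : pred I)
    (G : I -> R) :
  \big[op/idx]_(i | P i) G i = \big[op/idx]_(u : {i | P i}) G (val u).
Proof. exact: (big_sub P G). Qed.

Lemma polyfun_prod_neq0 (F : numFieldType) (T : Type) (I : Type) (r : seq I)
    (p : I -> (T -> F) -> F) :
  (forall i, polyfun (p i)) -> (forall i, exists x, p i x != 0) ->
  exists x, \prod_(i <- r) p i x != 0.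
Proof.
move=> pp p0; elim: r => [|i r IH]; first by exists (fun _ => 0); rewrite big_nil oner_neq0.
have [||x xP] := polyfunM_neq0 (pp i) (polyfun_prod r (P := predT) (p := p) _) (p0 i).
- by move=> k _.
- exact: IH.
by exists x; rewrite big_cons.
Qed.

Section CriticalCoefficients.
Variables (F : numFieldType) (T A : finType) (inc : T -> A -> bool) (I : {set A}).
Hypothesis oneI : forall w, (\sum_(a in I) inc w a = 1)%N.

(** Here [psi] stands for the inverses of the $\phi_a$ and [y w] for $\nu_w\prod_{a\in w}\phi_a$;
    the linear equations are $\phi_a\,\partial W/\partial\phi_a = 0$. *)
Definition critical_coeffs (nu : T -> F) := exists (psi : A -> F) (y : T -> F),
  [/\ exists w, y w != 0, forall a, \sum_w y w * (inc w a)%:R = 0 &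
      forall w, nu w = y w * mono (fun a => inc w a : nat) psi].

Let n := #|T|.
Let Mx : 'M[F]_(n, #|A|) := \matrix_(i, a) (inc (enum_val i) (enum_val a))%:R.
Let K := row_base (kermx Mx).
Let k := \rank (kermx Mx).

Let deg (al : T -> nat) (a : A) := (\sum_w al w * inc w a)%N.

(** The gauge degree is the exponent vector times the incidence matrix, so a maximal independent set
    of columns determines all its entries. *)
Lemma deg_determined (al be : T -> nat) :
  (forall i, deg al (enum_val (maxrankfun Mx^T i)) = deg be (enum_val (maxrankfun Mx^T i))) ->
  deg al =1 deg be.
Proof.
move=> E a.
pose v : 'cV[F]_n := \col_i ((al (enum_val i))%:R - (be (enum_val i))%:R).
have vE b : (Mx^T *m v) (enum_rank b) 0 = (deg al b)%:R - (deg be b)%:R.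
  rewrite mxE (reindex (enum_rank : T -> _)) /=; last first.
    by exists enum_val => i _; rewrite ?enum_rankK ?enum_valK.
  rewrite /deg !natr_sum -sumrB; apply: eq_bigr => w _.
  by rewrite !mxE !enum_rankK !natrM; ring.
have /submxP[C CE] : (Mx^T <= rowsub (maxrankfun Mx^T) Mx^T)%MS by rewrite eq_maxrowsub.
have s0 : rowsub (maxrankfun Mx^T) Mx^T *m v = 0.
  apply/colP => i; rewrite mxE; under eq_bigr do rewrite mxE.
  rewrite -[maxrankfun Mx^T i]enum_valK; have := vE (enum_val (maxrankfun Mx^T i)).
  by rewrite mxE E subrr => ->; rewrite mxE.
have := vE a; rewrite CE -mulmxA s0 mulmx0 mxE => /esym/eqP.
by rewrite subr_eq0 eqr_nat => /eqP.
Qed.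

Let ycoord (j : 'I_k) (w : T) (z : {i : 'I_k | i != j} -> F) : F :=
  K j (enum_rank w) + \sum_i z i * K (val i) (enum_rank w).

(* For fixed gauge degree the monomials in the coefficients depend only on the kernel
   coordinates; normalising one of them to 1 (by scaling I) leaves one parameter less
   than there are coefficients. *)
Lemma exists_relation (j : 'I_k) : exists2 p : (T -> F) -> F,
  polyfun p /\ (exists x, p x != 0) &
  forall (z : {i : 'I_k | i != j} -> F) (psi : A -> F),
    p (fun w => ycoord w z * mono (fun a => inc w a : nat) psi) = 0.
Proof.
have n_gt0 : (0 < n)%N by exact: leq_trans (leq_ltn_trans (leq0n j) (ltn_ord j)) (rank_leq_row (kermx Mx)).
have [L LP] := @expn_dominates 1 n n.-1 n ltac:(by rewrite prednK).
have kE : k = (n - \rank Mx)%N by rewrite /k mxrank_ker.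
pose G := {ffun 'I_(\rank Mx^T) -> 'I_(n * L).+1}.
pose Z := {ffun {i : 'I_k | i != j} -> 'I_(n * L).+1}.
pose A_ := {ffun T -> 'I_L.+1}.
have sumL (al : A_) : (\sum_w al w <= n * L)%N.
  by rewrite -sum_nat_const leq_sum // => w _; rewrite -ltnS.
have degL (al : A_) a : (deg (fun w => al w) a <= n * L)%N.
  by rewrite (leq_trans _ (sumL al)) // leq_sum // => w _; case: inc; rewrite ?muln1 ?muln0.
pose ga (al : A_) : G := [ffun i => inord (deg (fun w => al w) (enum_val (maxrankfun Mx^T i)))].
have gaP (al be : A_) : ga al = ga be -> deg (fun w => al w) =1 deg (fun w => be w).
  move=> /ffunP E; apply: deg_determined => i; have := congr1 (@nat_of_ord _) (E i).
  by rewrite !ffunE !inordK // ltnS.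
have yb w : boxpoly 1 (ycoord (j := j) w).
  apply: boxpolyD.
    apply: boxpoly_ext (@boxpoly_mono _ _ 1 (K j (enum_rank w)) (fun _ => 0%N) _) => // z.
    by rewrite mono0 mulr1.
  apply: boxpoly_sum => i.
  apply: boxpoly_ext (@boxpoly_mono _ _ 1 (K (val i) (enum_rank w)) (fun l => (l == i) : nat) _) => [z|l].
    by rewrite mono1 mulrC.
  exact: leq_b1.
have /choice[b bP] (al : A_) : exists b : Z -> F, forall z,
    mono (fun w => al w) (fun w => ycoord w z) = \sum_be b be * mono (fun i => be i) z.
  have := boxpoly_prod (fun w => boxpolyX (al w) (yb w)).
  move=> /(@boxpolyW _ _ _ (n * L)%N); apply.
  by under eq_bigr do rewrite mul1n; apply: sumL.
(* Carrying the gauge degree as an extra argument makes the dependence hold within each degree class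
   separately. *)
have [||c c0 cE] := @dep_of_span F (G * ({i : 'I_k | i != j} -> F)) A_ (G * Z)%type
    (fun al x => (ga al == x.1)%:R * mono (fun w => al w) (fun w => ycoord w x.2))
    (fun u x => (u.1 == x.1)%:R * mono (fun i => u.2 i) x.2).
- move=> al; exists (fun u => (ga al == u.1)%:R * b al u.2) => -[g z] /=.
  rewrite bP mulr_sumr.
  rewrite -(pair_big xpredT xpredT (fun g' be => ((ga al == g')%:R * b al be) * ((g' == g)%:R * mono (fun i => (be : Z) i) z))) /=.
  rewrite (bigD1 g) //= [X in _ + X]big1 ?addr0 => [|g' /negbTE ng].
    by apply: eq_bigr => be _; rewrite eqxx mul1r mulrA.
  by rewrite big1 // => be _; rewrite ng mul0r mulr0.
(* The rank of the incidence matrix plus the [k - 1] kernel coordinates leave [n - 1] free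
   exponents, against [n] for the monomials in the coefficients. *)
- rewrite card_prod !card_ffun !card_ord -expnD card_sig cardC1 card_ord.
  have -> : (\rank Mx^T + k.-1 = n.-1)%N.
    have := leq_ltn_trans (leq0n j) (ltn_ord j); have := rank_leq_row Mx; rewrite kE mxrank_tr; lia.
  rewrite (leq_ltn_trans _ LP) // mul1n.
  have nL : ((n * L).+1 <= n * L.+1)%N by rewrite mulnS -add1n leq_add2r.
  by elim: n.-1 => // i IH; rewrite !expnS leq_mul.
exists (fun nu => \sum_al c al * mono (fun w => al w) nu); first split.
- by apply: polyfun_sum => al _; apply: polyfunM; [exact: polyfun_cst|exact: polyfun_mono].
- apply: contrapT => H; have [al] := c0; rewrite (mono_free (c := c)) ?eqxx // => x.
  by apply/eqP/negP => /negP nz; apply: H; exists x.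
move=> z psi; rewrite (partition_big ga xpredT) //=; apply: big1 => g _.
have monE (al : A_) : mono (fun w => al w) (fun w => ycoord w z * mono (fun a => inc w a : nat) psi)
    = mono (fun w => al w) (fun w => ycoord w z) * mono (deg (fun w => al w)) psi.
  rewrite /mono; under eq_bigr do rewrite exprMn; rewrite big_split /=; congr (_ * _).
  under eq_bigr do rewrite -prodrXl; rewrite exchange_big /=; apply: eq_bigr => a _.
  by rewrite /deg expr_sum; apply: eq_bigr => w _; rewrite -exprM mulnC.
have [al0 /eqP g0|none] := pickP (fun al => ga al == g); last by rewrite big_pred0.
(* Within one degree class all monomials contribute the same monomial in [psi], which factors
   out. *)
rewrite (eq_bigr (fun al => c al * mono (fun w => al w) (fun w => ycoord w z) * mono (deg (fun w => al0 w)) psi)).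
  rewrite -mulr_suml [X in X * _](_ : _ = 0) ?mul0r //.
  rewrite -[RHS](cE (g, z)) big_mkcond /=; apply: eq_bigr => al _.
  by case: eqP => _; rewrite ?mul1r ?mul0r ?mulr0.
move=> al /eqP gal; rewrite monE mulrA; congr (_ * _).
by apply: eq_bigr => a _; congr (_ ^+ _); apply: gaP; rewrite gal.
Qed.

(** Some kernel coordinate of [y] is nonzero but it is not known which, so the relations for all
    choices are multiplied. *)
Lemma critical_coeffs_thin : exists2 p : (T -> F) -> F,
  polyfun p /\ (exists x, p x != 0) & forall nu, critical_coeffs nu -> p nu = 0.
Proof.
have /choice[p pP] (j : 'I_k) : exists p : (T -> F) -> F,
    [/\ polyfun p, exists x, p x != 0 & forall (z : {i : 'I_k | i != j} -> F) (psi : A -> F),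
        p (fun w => ycoord w z * mono (fun a => inc w a : nat) psi) = 0].
  by have [p [? ?] ?] := exists_relation j; exists p.
exists (fun nu => \prod_j p j nu); first split.
- by apply: polyfun_prod => j _; have [] := pP j.
- by apply: polyfun_prod_neq0 => j; have [] := pP j.
move=> nu [psi [y [[w0 yw0] yM nuE]]].
pose yr : 'rV[F]_n := \row_i y (enum_val i).
have yrE w : yr 0 (enum_rank w) = y w by rewrite mxE enum_rankK.
have /submxP[z zE] : (yr <= K)%MS.
  rewrite eq_row_base; apply/sub_kermxP/rowP => a; rewrite !mxE -[RHS](yM (enum_val a)).
  rewrite (reindex (enum_rank : T -> _)) /=; last first.
    by exists enum_val => i _; rewrite ?enum_rankK ?enum_valK.
  by apply: eq_bigr => w _; rewrite yrE mxE enum_rankK.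
have [j zj] : exists j, z 0 j != 0.
  apply: contrapT => H; move: yw0; rewrite -yrE zE mxE big1 ?eqxx // => i _.
  have [->|nz] := eqVneq (z 0 i) 0; first by rewrite mul0r.
  by case: H; exists i.
have [_ _ p0] := pP j.
rewrite (bigD1 j) //= [X in X * _](_ : _ = 0) ?mul0r //.
(* Dividing by [z 0 j] normalises coordinate [j] to 1; the factor goes into [psi] on [I], which
   every cycle meets exactly once. *)
rewrite -[RHS](p0 (fun i => z 0 (val i) / z 0 j) (fun a => psi a * (if a \in I then z 0 j else 1))).
congr (p j _); apply/funext => w; rewrite nuE.
have -> : mono (fun a => inc w a : nat) (fun a => psi a * (if a \in I then z 0 j else 1))
    = mono (fun a => inc w a : nat) psi * z 0 j.
  rewrite /mono; under eq_bigr do rewrite exprMn; rewrite big_split /=; congr (_ * _).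
  rewrite (bigID [in I]) /= [X in _ * X]big1 ?mulr1 => [|a /negbTE->]; last by rewrite expr1n.
  under eq_bigr => a aI do rewrite aI.
  by rewrite -expr_sum oneI expr1.
have -> : y w = ycoord w (fun i : {i : 'I_k | i != j} => z 0 (val i) / z 0 j) * z 0 j.
  rewrite -yrE zE mxE (bigD1 j) //= /ycoord mulrDl mulr_suml mulrC; congr (_ + _).
  rewrite (big_sig_val _ (fun i => i != j)); apply: eq_bigr => i _.
  by rewrite mulrAC divfK.
by rewrite mulrAC mulrA.
Qed.
End CriticalCoefficients.

(** * Topology of coefficient spaces and gradients of potentials *)

(** Otherwise the real unit interval would be countable and have Lebesgue measure 0. *)
Lemma uncountable_complex (R : realType) : ~ countable [set: R[i]].
Proof.
move=> /countable_injP[f f_inj].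
have cR : countable `[0 : R, 1]%classic.
  apply/countable_injP; exists (fun x => f x%:C) => x y _ _ /f_inj.
  by rewrite !in_setE => /(_ I I) [].
have := countable_lebesgue_measure0 cR.
rewrite lebesgue_measure_itv /= lte_fin ltr01 oppr0 adde0 => /eqP.
by rewrite eqe oner_eq0.
Qed.

Lemma polyfun_continuous (F : numFieldType) (I : Type) (T : topologicalType) (x : T -> I -> F)
    (p : (I -> F) -> F) :
  (forall i, continuous (fun t => x t i : F^o)) -> polyfun p ->
  continuous (fun t => p (x t) : F^o).
Proof.
move=> cx; elim=> [c|i|p1 p2 _ c1 _ c2|p1 p2 _ c1 _ c2] //=.
- by move=> t; exact: (@cvg_cst F^o).
- move=> t; exact: (@cvgD F F^o T (nbhs t) _ (fun t => p1 (x t)) (fun t => p2 (x t)) _ _ (c1 t) (c2 t)).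
- move=> t; exact: (@cvgM F T (nbhs t) _ (fun t => p1 (x t)) (fun t => p2 (x t)) _ _ (c1 t) (c2 t)).
Qed.

(** The neighbourhood contains the distinct points $e/(k+2)$, more of them than [P] can have
    roots. *)
Lemma poly_near0_neq0 (F : numFieldType) (P : {poly F}) (A : set F^o) :
  P != 0 -> nbhs (0 : F^o) A -> exists2 t, A t & P.[t] != 0.
Proof.
move=> Pn0 /nbhs_ballP[e /= e0 eA]; apply: contrapT => H.
have := @max_poly_roots F P (mkseq (fun k => e / k.+2%:R) (size P)) Pn0.
rewrite size_mkseq ltnn => H'; suff: false by []; apply: H'.
  apply/allP => _ /mapP[k _ ->]; apply: contrapT => /negP nr; apply: H.
  exists (e / k.+2%:R) => //; apply: eA; rewrite /ball /= sub0r normrN.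
  by rewrite ger0_norm ?divr_ge0 ?ltW // ltr_pdivrMr // ltr_pMr // ltr1n.
apply: mkseq_uniq => i j /(mulfI (lt0r_neq0 e0)) /invr_inj /eqP.
by rewrite eqr_nat => /eqP[].
Qed.

Section Topology.
Variables (F : numFieldType) (I : eqType).
Implicit Types (p : (I -> F) -> F).

Lemma polyfun_neq0_open p : polyfun p -> open ([set x | p x != 0]%classic : set {ptws I -> F^o}).
Proof.
move=> pp; have : open ((fun x : {ptws I -> F^o} => p x : F^o) @^-1` (~` [set 0]))%classic.
  apply: open_comp => [x _|].
    apply: (polyfun_continuous (x := fun x : {ptws I -> F^o} => x)) => // i.
    exact: (@proj_continuous I (fun _ => F^o) i).
  rewrite openC; apply: accessible_closed_set1; apply: hausdorff_accessible.
  exact: (@norm_hausdorff F F^o).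
by congr open; apply/seteqP; split => x /= /eqP.
Qed.

(** On the line from a point of the open set to a nonzero of [p], the polynomial [p] is nonzero at
    parameters arbitrarily close to 0. *)
Lemma polyfun_neq0_dense p : polyfun p -> (exists x, p x != 0) ->
  dense ([set x | p x != 0]%classic : set {ptws I -> F^o}).
Proof.
move=> pp [v pv] O [u Ou] oO.
pose l i : {poly F} := (u i)%:P + (v i - u i) *: 'X.
have lE t i : (l i).[t] = u i + (v i - u i) * t.
  by rewrite /l hornerD hornerC hornerZ hornerX.
have [P PE] := polyfun_curve l pp.
have Pn0 : P != 0.
  apply: contraNneq pv => P0; have := PE 1; rewrite P0 horner0 => <-.
  by rewrite (_ : (fun _ => _) = v) //; apply/funext => i; rewrite lE mulr1 addrC subrK.
have lc : continuous ((fun t i => (l i).[t]) : F^o -> {ptws I -> F^o}).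
  move=> t; have FF : Filter (nbhs (t : F^o)) := nbhs_filter t.
  have FF' := @fmap_filter _ _ (fun (t : F^o) i => (l i).[t]) _ FF.
  apply/cvg_sup => i; apply/cvg_image.
    by rewrite eqEsubset; split=> w // _; exists (cst w).
  move=> W /= Wt; exists ((fun g : I -> F => g i) @^-1` W)%classic.
    have : continuous (fun t : F^o => (l i).[t] : F^o).
      have := @polyfun_continuous F unit F^o (fun t _ => t) (fun x => u i + (v i - u i) * x tt).
      have pl : polyfun (fun x : unit -> F => u i + (v i - u i) * x tt).
        by apply: polyfunD; [exact: polyfun_cst|apply: polyfunM; [exact: polyfun_cst|exact: polyfun_coord]].
      move=> /(_ _ pl) H; rewrite (_ : (fun _ => _) = (fun t => u i + (v i - u i) * t)).
        by apply: H => _ z; exact: cvg_id.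
      by apply/funext => z; rewrite lE.
    by move=> /(_ t W Wt).
  by rewrite eqEsubset; split => [j [? + <-//]|j Wj]; exists (fun _ => j).
have O0 : nbhs (0 : F^o) ((fun t : F^o => (fun i => (l i).[t]) : {ptws I -> F^o}) @^-1` O)%classic.
  apply: lc; apply: open_nbhs_nbhs; split => //.
  by rewrite (_ : (fun _ => _) = u) //; apply/funext => i; rewrite lE mulr0 addr0.
have [t Ot Pt] := poly_near0_neq0 Pn0 O0.
by exists (fun i => (l i).[t]); split => //=; rewrite PE.
Qed.
End Topology.

Lemma derive1_affine (F : numFieldType) (a b x : F) :
  derive1 (fun z : F => a * z + b : F^o) x = a.
Proof.
rewrite derive1E; apply: derive_val.
have := @is_deriveD F F^o F^o (fun z : F^o => a *: z) (fun _ => b) x 1 (a *: 1) 0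
  (@is_deriveZ F F^o F^o id a x 1 1 (is_derive_id _ _)) (is_derive_cst _ _ _).
by rewrite addr0 /GRing.scale /= mulr1.
Qed.

(** * Gradients of potentials and the generic vanishing property *)

Section Gradient.
Variables (F : comNzRingType) (A : finType).
Implicit Types (c : {set A} -> F) (phi : A -> F).

Definition grad c phi (a : A) : F :=
  \sum_(w : {set A} | a \in w) c w * \prod_(b in w :\ a) phi b.

Lemma polyfun_grad (I : Type) c (x : (I -> F) -> A -> F) a :
  (forall b, polyfun (fun y => x y b)) -> polyfun (fun y => grad c (x y) a).
Proof.
move=> xP; apply: polyfun_sum => w _; apply: polyfunM; first exact: polyfun_cst.
by apply: polyfun_prod.
Qed.
End Gradient.

(** Extension by zero to all sets of arrows, so that potentials on different sets of cycles can be
    compared. *)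
Definition coef (R : realType) (Q : quiver) (K : {set {set arrow Q}}) (nu : coeffs R K)
    (w : {set arrow Q}) : R[i] :=
  if insub w is Some u then nu u else 0.

Lemma coefE (R : realType) (Q : quiver) (K : {set {set arrow Q}}) (nu : coeffs R K)
    (u : {w | w \in K}) : coef nu (val u) = nu u.
Proof. by rewrite /coef valK. Qed.

Lemma coef_notin (R : realType) (Q : quiver) (K : {set {set arrow Q}}) (nu : coeffs R K) w :
  w \notin K -> coef nu w = 0.
Proof. by move=> wK; rewrite /coef insubN. Qed.

(** A cycle is a set of arrows, so the potential is affine in each variable. *)
Lemma partial_potential (R : realType) (Q : quiver) (K : {set {set arrow Q}}) (nu : coeffs R K)
    (a : arrow Q) (phi : abelian_rep R Q) :
  partial (potential nu) a phi = grad (coef nu) phi a.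
Proof.
rewrite /partial.
rewrite (_ : (fun z : R[i] => _) = (fun z : R[i] => grad (coef nu) phi a * z +
   \sum_(w : {set arrow Q} | a \notin w) coef nu w * \prod_(b in w) phi b)).
  exact: (@derive1_affine R[i]).
apply/funext => z; rewrite /potential.
transitivity (\sum_(w : {set arrow Q}) coef nu w * \prod_(b in w) [eta phi with a |-> z] b).
  rewrite (bigID (fun w => w \in K)) /= [X in _ + X]big1 ?addr0; last first.
    by move=> w wK; rewrite coef_notin // mul0r.
  rewrite (big_sub K (fun w => coef nu w * _)); apply: eq_bigr => u _.
  by rewrite coefE.
rewrite (bigID (fun w : {set arrow Q} => a \in w)) /=; congr (_ + _).
  rewrite /grad mulr_suml; apply: eq_bigr => w aw.
  rewrite (big_setD1 a) //= eqxx -mulrA; congr (_ * _); rewrite mulrC; congr (_ * _).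
  by apply: eq_bigr => b; rewrite !inE => /andP[/negbTE->].
apply: eq_bigr => w aw; congr (_ * _); apply: eq_bigr => b bw.
by rewrite /=; case: eqP => // ba; rewrite -ba bw in aw.
Qed.

(** Let [A] be the support of a critical point with a nonvanishing cycle. The coefficients of the
    cycles inside [A] satisfy [critical_coeffs], hence a relation depending only on [A]; the product
    over the finitely many [A] excludes them all. *)
Lemma vanishing_polyfun (R : realType) (Q : quiver) (K : {set {set arrow Q}}) (I : {set arrow Q}) :
  (forall w, w \in K -> #|w :&: I| = 1%N) ->
  exists p : ({w | w \in K} -> R[i]) -> R[i],
  [/\ polyfun p, exists x, p x != 0 &
      forall nu : coeffs R K, p nu != 0 -> forall phi : abelian_rep R Q,
        (forall a, grad (coef nu) phi a = 0) ->
        forall w, w \in K -> \prod_(a in w) phi a = 0].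
Proof.
move=> KI.
have thin (A : {set arrow Q}) : exists p : ({w | w \in K} -> R[i]) -> R[i],
    [/\ polyfun p, exists x, p x != 0 & forall nu : {w | w \in K} -> R[i],
      critical_coeffs (fun (u : {u : {w | w \in K} | val u \subset A}) a => a \in val (val u))
        (fun u => nu (val u)) -> p nu = 0].
  have [|p [pp [x px]] pE] := @critical_coeffs_thin R[i] {u : {w | w \in K} | val u \subset A}
    (arrow Q) (fun u a => a \in val (val u)) I.
    move=> u; rewrite -(KI _ (valP (val u))) -sum1_card big_mkcond [RHS]big_mkcond.
    by apply: eq_bigr => a _; rewrite inE andbC; case: (a \in I); case: (_ \in _).
  exists (fun nu => p (fun u => nu (val u))); split.
  - by apply: (polyfun_comp (s := fun u y => y (val u))) pp => u; apply: polyfun_coord.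
  (* Cycles not inside [A] do not enter the relation; the value 0 is arbitrary. *)
  - exists (fun u => if insub u is Some v then x v else 0).
    by rewrite (_ : (fun _ => _) = x) //; apply/funext => u; rewrite valK.
  - by move=> nu /pE.
have [p pP] := choice thin.
(* The first factor forces all coefficients to be nonzero, so that a nonvanishing cycle gives a
   nonzero entry of [y] below. *)
exists (fun nu => (\prod_u nu u) * \prod_A p A nu); split.
- apply: polyfunM; first by apply: polyfun_prod => u _; apply: polyfun_coord.
  by apply: polyfun_prod => A _; have [] := pP A.
- apply: polyfunM_neq0.
  + by apply: polyfun_prod => u _; apply: polyfun_coord.
  + by apply: polyfun_prod => A _; have [] := pP A.
  + by exists (fun _ => 1); rewrite big1 // oner_neq0.
  + by apply: polyfun_prod_neq0 => A; have [] := pP A.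
move=> nu; rewrite mulf_eq0 negb_or => /andP[/prodf_neq0 nu0 /prodf_neq0 p0] phi crit w0 w0K.
apply/eqP/negP => /negP w0n0.
pose A := finset (fun a => phi a != 0).
have subA (w : {set arrow Q}) : (\prod_(a in w) phi a != 0) = (w \subset A).
  apply/prodf_neq0/fintype.subsetP => H a aw; last by have := H a aw; rewrite inE.
  by rewrite inE; apply: H.
have [_ _ pE] := pP A; move: (p0 A isT); rewrite pE ?eqxx //.
pose y (u : {u : {w | w \in K} | val u \subset A}) : R[i] := nu (val u) * \prod_(a in val (val u)) phi a.
exists (fun a => (phi a)^-1), y; split.
- pose u0 : {w | w \in K} := exist _ w0 w0K.
  have w0A : val u0 \subset A by rewrite -subA.
  by exists (exist (fun u : {w | w \in K} => val u \subset A) u0 w0A); rewrite /y /= mulf_neq0 ?nu0.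
- move=> a; transitivity (phi a * grad (coef nu) phi a); last by rewrite crit mulr0.
  transitivity (\sum_(u : {w | w \in K}) nu u * (\prod_(b in val u) phi b) * (a \in val u)%:R).
    rewrite [RHS](bigID (fun u : {w | w \in K} => val u \subset A)) /= [X in _ + X]big1 ?addr0.
      by rewrite (big_sig_val _ (fun u : {w | w \in K} => val u \subset A)).
    by move=> u; rewrite -subA negbK => /eqP->; rewrite mulr0 mul0r.
  rewrite /grad mulr_sumr [RHS]big_mkcond /= [RHS](bigID (fun w => w \in K)) /= [X in _ + X]big1 ?addr0; last first.
    by move=> w wK; case: ifP => // _; rewrite coef_notin // mul0r mulr0.
  rewrite [RHS](big_sub K) /=.
  apply: eq_bigr => u _; rewrite coefE; case: ifP => au; rewrite ?mulr0 // mulr1 mulrCA.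
  by rewrite (big_setD1 a au).
- move=> u; rewrite /y -mulrA (_ : _ * mono _ _ = 1) ?mulr1 //.
  have -> : mono (fun a => a \in val (val u)) (fun a => (phi a)^-1) =
      \prod_(a in val (val u)) (phi a)^-1.
    rewrite [RHS]big_mkcond; apply: eq_bigr => a _.
    by case: (_ \in _); rewrite ?expr1 ?expr0.
  rewrite -big_split /= big1 // => a au; rewrite mulfV //.
  by have /fintype.subsetP/(_ a au) := valP u; rewrite inE.
Qed.

(** * Stability and integer potentials *)

Section Stability.
Variable Q : quiver.
Implicit Types (B : {set arrow Q}) (S : {set node Q}) (th : node Q -> int).

Definition arrow_closed B S : Prop := forall a, a \in B -> src a \in S -> tgt a \in S.

Definition stable th B : Prop := forall S, arrow_closed B S ->
  S != finset.set0 -> S != [set: node Q] -> \sum_(i in S) th i < 0.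

Lemma stableS th B B' : B \subset B' -> stable th B -> stable th B'.
Proof.
by move=> /fintype.subsetP sB st S cS; apply: st => a /sB; apply: cS.
Qed.

Lemma sum_setC th S : \sum_i th i = 0 -> \sum_(i in ~: S) th i = - \sum_(i in S) th i.
Proof.
rewrite (bigID [in S]) /= => /eqP; rewrite addr_eq0 => /eqP->; rewrite opprK.
by apply: eq_bigl => i; rewrite inE.
Qed.

Lemma layer_cake th (g : node Q -> nat) N : (forall i, g i <= N)%N ->
  \sum_i th i * (g i)%:Z = \sum_(k < N) \sum_(i in finset (fun i => k < g i)%N) th i.
Proof.
move=> gN; under [RHS]eq_bigr do rewrite big_mkcond.
rewrite exchange_big /=; apply: eq_bigr => i _.
under eq_bigr do rewrite inE; rewrite -big_mkcond /= sumr_const -mulr_natr; congr (_ * _).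
rewrite -[LHS]natz; congr _%:R.
by rewrite -sum1_card -(big_ord_widen N (fun _ => 1%N) (gN i)) sum1_card card_ord.
Qed.

(** Superlevel sets of [g] are closed, so the layer cake formula gives a sum of nonpositive terms.
    If [g] is not constant, one level is nonempty and proper, and stability makes its term
    negative. *)
Lemma monotone_pairing th B (g : node Q -> int) : \sum_i th i = 0 ->
  (forall S, arrow_closed B S -> \sum_(i in S) th i <= 0) ->
  (forall a, a \in B -> g (src a) <= g (tgt a)) ->
  \sum_i th i * g i <= 0 /\
  (stable th B -> (exists i j, g i < g j) -> \sum_i th i * g i < 0).
Proof.
move=> th0 ss gB.
(* Shifting [g] to nonnegative values does not change the pairing, since [th] has sum 0. *)
pose m : int := \sum_j `|g j|; have gm i : 0 <= g i + m.
  rewrite /m (bigD1 i) //= addrA addr_ge0 ?sumr_ge0 //; lia.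
pose g' i := absz (g i + m).
have g'E i : (g' i)%:Z = g i + m by rewrite /g' gez0_abs.
have E : \sum_i th i * g i = \sum_i th i * (g' i)%:Z.
  under [RHS]eq_bigr do rewrite g'E mulrDr; rewrite big_split /= -mulr_suml th0 mul0r addr0 //.
have gN i : (g' i <= \max_j g' j)%N := leq_bigmax i.
have cS k : arrow_closed B (finset (fun i => k < g' i)%N).
  move=> a /gB; rewrite !inE -!ltz_nat !g'E; lia.
rewrite E (layer_cake th gN); split; first by apply: sumr_le0 => k _; apply: ss.
move=> st [i [j ij]].
have ij' : (g' i < g' j)%N by rewrite -ltz_nat !g'E ltrD2r.
rewrite (bigD1 (Ordinal (leq_trans ij' (gN j)))) //=.
rewrite ltr_wnDr //; first by apply: sumr_le0 => k _; apply: ss.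
apply: st => //; first by apply/set0Pn; exists j; rewrite inE.
by apply/eqP => /setP/(_ i); rewrite !inE ltnn.
Qed.

(** * The integer program for feasible potentials *)

Section Potential.
Variables (th : node Q -> int) (B : {set arrow Q}) (c : arrow Q -> int).
Hypothesis th_sum : \sum_i th i = 0.
Hypothesis th_gen : forall S, S != finset.set0 -> S != [set: node Q] -> \sum_(i in S) th i != 0.
Hypothesis stB : stable th B.
Hypothesis c_le1 : forall a, `|c a| <= 1.

Definition feasible (h : node Q -> nat) :=
  forall a, a \in B -> 0 <= c a + (h (src a))%:Z - (h (tgt a))%:Z.

Lemma pairing_indicator S (h h' : node Q -> nat) (e : int) :
  (forall i, (h' i)%:Z = (h i)%:Z + e * (i \in S)%:R) ->
  \sum_i th i * (h' i)%:Z = \sum_i th i * (h i)%:Z + e * \sum_(i in S) th i.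
Proof.
move=> hE; under eq_bigr do rewrite hE mulrDr; rewrite big_split /= mulr_sumr; congr (_ + _).
rewrite [RHS]big_mkcond; apply: eq_bigr => i _; case: (i \in S); rewrite ?mulr1 ?mulr0 // mulrC //.
Qed.

(* A value missed by a feasible potential cuts off a closed set, so the part above the
   gap can be lowered. *)
Lemma feasible_compress (h : node Q -> nat) : feasible h ->
  exists h', [/\ feasible h', forall i, (h' i <= #|node Q|)%N &
    \sum_i th i * (h' i)%:Z <= \sum_i th i * (h i)%:Z].
Proof.
have [n] := ubnP (\sum_i h i); elim: n h => // n IH h hn fh.
have [/forallP hN|/existsP[i0 hi0]] := boolP [forall i, h i <= #|node Q|]%N; first by exists h.
rewrite -ltnNge in hi0.
have [v vh] : exists v : 'I_#|node Q|.+1, forall i, h i != v.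
  apply: contrapT => H; pose im := codom (fun i => inord (h i) : 'I_#|node Q|.+1).
  have : (#|'I_#|node Q|.+1| <= #|im|)%N.
    apply/subset_leq_card/fintype.subsetP => v _; apply: contrapT => vim; apply: H.
    exists v => i; apply: contra_notN vim => /eqP hv.
    by apply/codomP; exists i; rewrite hv inord_val.
  by rewrite card_ord leqNgt ltnS leq_image_card.
pose S := finset (fun i => v < h i)%N.
pose h' i := (h i - (i \in S))%N.
have h'E i : (h' i)%:Z = (h i)%:Z + (-1) * (i \in S)%:R.
  by rewrite /h' inE; case: ltnP => ?; lia.
have i0S : i0 \in S by rewrite inE (leq_trans _ hi0) // ltn_ord.
have [||h'' [fh'' h''N h''le]] := IH h'.
- rewrite ltnS in hn; apply: leq_trans hn; rewrite (bigD1 i0) //= [X in (_ <= X)%N](bigD1 i0) //=.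
  rewrite -addSn leq_add //; first by rewrite /h' i0S; move: hi0; lia.
  by apply: leq_sum => i _; rewrite leq_subr.
- move=> a aB; have := fh a aB; rewrite !h'E !inE.
  have := vh (src a); have := vh (tgt a); have := c_le1 a.
  by case: ltnP; case: ltnP; lia.
exists h''; split => //; apply: le_trans h''le _.
rewrite (pairing_indicator h'E) mulN1r gerDl oppr_le0.
rewrite -[S]finset.setCK sum_setC // oppr_ge0.
have [->|S0] := eqVneq (~: S) finset.set0; first by rewrite big_set0.
apply/ltW/stB => //; last first.
  by apply: contraTneq i0S => SC; rewrite -[S]finset.setCK SC finset.setCT inE.
(* Feasibility lets [h] grow by at most 1 along an arrow of [B], so from below the missed value [v]
   it cannot get above it. *)
move=> a aB; have := fh a aB; rewrite !inE -!leqNgt.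
have := vh (src a); have := vh (tgt a); have := c_le1 a; lia.
Qed.

(** Compression bounds the potentials, so a minimiser of the pairing exists. Its tight arrows are
    stable: raising it outside a set [S] closed under them stays feasible, so minimality gives [S]
    nonpositive weight, and genericity excludes 0. *)
Lemma feasible_stable h0 : feasible h0 -> exists2 h, feasible h &
  stable th (finset (fun a => (a \in B) && (c a + (h (src a))%:Z - (h (tgt a))%:Z == 0))).
Proof.
move=> /feasible_compress[h1 [fh1 h1N _]].
pose F (h : {ffun node Q -> 'I_#|node Q|.+1}) := \sum_i th i * (h i : nat)%:Z.
pose P (h : {ffun node Q -> 'I_#|node Q|.+1}) := `[< feasible (fun i => h i) >].
have Ph1 : P [ffun i => inord (h1 i)].
  by apply/asboolP => a aB; rewrite !ffunE !inordK ?ltnS //; apply: fh1.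
have [h /asboolP fh hmin] := Order.TotalTheory.arg_minP F Ph1.
exists (fun i => h i : nat) => // S cS S0 ST.
have /feasible_compress[h2 [fh2 h2N h2le]] : feasible (fun i => h i + (i \in ~: S))%N.
  move=> a aB; have := fh a aB; rewrite !inE.
  have := cS a; rewrite inE aB /=.
  case: (c a + _ - _ =P 0) => [_ /(_ isT) H|nz _]; last first.
    by move: nz; case: (src a \in S); case: (tgt a \in S) => /=; lia.
  by move: H; case: (src a \in S) => [/(_ isT)->|_]; [|case: (tgt a \in S)] => /=; lia.
have Ph2 : P [ffun i => inord (h2 i)].
  by apply/asboolP => a aB; rewrite !ffunE !inordK ?ltnS //; apply: fh2.
have := hmin _ Ph2; rewrite {2}/F.
under [X in _ <= X]eq_bigr do rewrite ffunE inordK ?ltnS //.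
move=> /le_trans/(_ h2le).
rewrite (@pairing_indicator (~: S) (fun i => h i : nat) _ 1) => [|i]; last by case: (_ \in _); lia.
rewrite mul1r lerDl sum_setC // oppr_ge0 le_eqVlt => /orP[/eqP E|//].
by have := th_gen S0 ST; rewrite E eqxx.
Qed.

End Potential.
End Stability.

(** * Simple cycles and directed paths *)

Section Cycles.
Variable Q : quiver.
Implicit Types (a b : arrow Q) (B w : {set arrow Q}).

Lemma path_incidentE a q :
  path (fun a b => tgt a == src b) a q = (map (@src Q) q == belast (tgt a) (map (@tgt Q) q)).
Proof. by elim: q a => //= b q IH a; rewrite IH eqseq_cons eq_sym. Qed.

(** Along a closed path the list of targets is a rotation of the list of sources. *)
Lemma simple_cycle_balance (V : nmodType) (g : node Q -> V) w : w \in simple_cycles Q ->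
  \sum_(a in w) g (src a) = \sum_(a in w) g (tgt a).
Proof.
move=> /simple_cyclesP[[//|x p] /and3P[_ /= cp up] cw].
have uc := map_uniq (f := @src Q) (s := x :: p) up.
have sumE (G : arrow Q -> V) : \sum_(a in w) G a = \sum_(a <- x :: p) G a.
  by rewrite big_uniq //; apply: eq_bigl => a; rewrite cw.
rewrite !sumE.
rewrite [LHS](perm_big (rcons p x)) /=; last by rewrite perm_sym perm_rcons.
rewrite -(big_map (@src Q) xpredT g) -(big_map (@tgt Q) xpredT g) /=.
move: cp; rewrite path_incidentE => /eqP ->.
by rewrite map_rcons belast_rcons.
Qed.

Definition arrow_rel B : rel (node Q) := fun i j =>
  [exists a in B, (src a == i) && (tgt a == j)].

Lemma arrow_relP B a : a \in B -> arrow_rel B (src a) (tgt a).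
Proof. by move=> aB; apply/exists_inP; exists a; rewrite ?eqxx. Qed.

Lemma arrow_path B x p : path (arrow_rel B) x p ->
  exists q : seq (arrow Q), [/\ map (@src Q) q = belast x p, map (@tgt Q) q = p &
    {subset q <= B}].
Proof.
elim: p x => [|y p IH] x /=; first by exists [::].
case/andP => /exists_inP[a aB /andP[/eqP sa /eqP ta]] /IH[q [sq tq qB]].
exists (a :: q); rewrite /= sq tq sa ta; split => // b.
by rewrite inE => /predU1P[->|/qB].
Qed.

Lemma simple_cycle_through B a : a \in B -> connect (arrow_rel B) (tgt a) (src a) ->
  exists2 w, w \in simple_cycles Q & (a \in w) && (w \subset B).
Proof.
move=> aB /connectP[p0 /shortenP[p pp up _] lp].
have [q [sq tq qB]] := arrow_path pp.
have c_cyc : is_simple_cycle (a :: q).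
  apply/and3P; split => //=.
    by rewrite path_incidentE !map_rcons sq tq belast_rcons lp -lastI.
  by move: up; rewrite sq lp lastI rcons_uniq.
exists (finset (mem (a :: q))).
  by apply/simple_cyclesP; exists (a :: q) => [//|b]; rewrite [RHS]inE.
rewrite !inE eqxx; apply/fintype.subsetP => b; rewrite !inE.
by case/predU1P => [->|/qB].
Qed.

End Cycles.

(** * Arrow weights and the pairing with zeta *)

Section Weights.
Variables (Q : quiver) (I : {set arrow Q}).
Implicit Types (f : node Q -> int) (a : arrow Q) (w : {set arrow Q}).

Definition wt f a : int := (a \in I)%:Z + f (src a) - f (tgt a).

Lemma sum_wt_cycle f w : w \in simple_cycles Q -> \sum_(a in w) wt f a = #|w :&: I|%:Z.
Proof.
move=> wQ; rewrite /wt sumrB big_split /= (simple_cycle_balance f wQ) addrK.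
rewrite -sum1_card -natz natr_sum big_mkcond [RHS]big_mkcond; apply: eq_bigr => a _.
by rewrite inE; case: (a \in w); case: (a \in I).
Qed.

Lemma sum_by_node (h : arrow Q -> node Q) f :
  \sum_a f (h a) = \sum_i #|finset (fun a => h a == i)|%:Z * f i.
Proof.
rewrite (partition_big h xpredT) //=; apply: eq_bigr => i _.
rewrite (eq_bigr (fun _ => f i)) => [|a /eqP-> //].
rewrite sumr_const -mulr_natl -natz; congr (_%:R * _); apply: eq_card => a.
by rewrite !inE.
Qed.

Lemma sum_zeta_mul f : \sum_i zeta i * f i = \sum_a (f (tgt a) - f (src a)).
Proof.
rewrite sumrB !sum_by_node -sumrB; apply: eq_bigr => i _.
by rewrite /zeta mulrBl.
Qed.

Lemma sum_zeta : \sum_(i : node Q) zeta i = 0.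
Proof.
have := sum_zeta_mul (fun _ => 1); under eq_bigr do rewrite mulr1.
by move=> ->; rewrite big1.
Qed.

Lemma sum_wt f : \sum_a wt f a = #|I|%:Z - \sum_i zeta i * f i.
Proof.
rewrite sum_zeta_mul -sumrN /wt.
under eq_bigr do rewrite -addrA; rewrite big_split /=; congr (_ + _).
  rewrite -sum1_card -natz natr_sum [RHS]big_mkcond; apply: eq_bigr => a _.
  by case: (a \in I).
by apply: eq_bigr => a _; rewrite opprB.
Qed.

End Weights.

(* A perturbation of n * zeta, n the number of nodes, for which every semistable
   representation is stable. *)
Definition theta (Q : quiver) (i0 i : node Q) : int :=
  #|node Q|%:Z * zeta i + 1 - (i == i0)%:Z * #|node Q|%:Z.

Section Theta.
Variables (Q : quiver) (i0 : node Q).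
Implicit Types (S : {set node Q}) (B : {set arrow Q}).

Lemma sum_theta_in S : \sum_(i in S) theta i0 i =
  #|node Q|%:Z * (\sum_(i in S) zeta i) + #|S|%:Z - (i0 \in S)%:Z * #|node Q|%:Z.
Proof.
rewrite /theta sumrB big_split /= -mulr_sumr; congr (_ + _ - _).
  by rewrite -sum1_card -natz natr_sum.
rewrite -mulr_suml; congr (_ * _); rewrite big_mkcond (bigD1 i0) //= eqxx big1 ?addr0.
  by case: (_ \in _).
by move=> i /negbTE->; case: (_ \in _).
Qed.

Lemma sum_theta : \sum_i theta i0 i = 0.
Proof.
rewrite -(eq_bigl _ _ (fun i => @finset.in_setT _ i)) sum_theta_in cardsT finset.in_setT.
rewrite (eq_bigl _ _ (fun i => @finset.in_setT _ i)) sum_zeta; lia.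
Qed.

Lemma card_proper S : S != finset.set0 -> S != [set: node Q] ->
  (0 < #|S|)%N && (#|S| < #|node Q|)%N.
Proof.
rewrite -card_gt0 => -> /=; rewrite -finset.properT => /proper_card.
by rewrite cardsT.
Qed.

(** Modulo $n = |Q_0|$ the sum is $|S|$, which lies strictly between 0 and $n$. *)
Lemma theta_generic S : S != finset.set0 -> S != [set: node Q] -> \sum_(i in S) theta i0 i != 0.
Proof.
move=> S0 /(card_proper S0)/andP[]; rewrite sum_theta_in.
move: (\sum_(i in S) _) #|S| #|node Q| => z s n s0 sn; apply/eqP.
have pos (y : int) : 0 <= y -> 0 <= n%:Z * y by move=> y0; apply: mulr_ge0.
case: (i0 \in S); rewrite ?mul1r ?mul0r => E.
  have [z0|z1] := lerP z 0; first by have := pos (- z); lia.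
  by have := pos (z - 1); lia.
have [z0|z1] := lerP 0 z; first by have := pos z; lia.
by have := pos (- z - 1); lia.
Qed.

Lemma theta_stable B : stable (@zeta Q) B -> stable (theta i0) B.
Proof.
move=> st S cS S0 ST; have := st S cS S0 ST; have /andP[] := card_proper S0 ST.
rewrite sum_theta_in.
move: (\sum_(i in S) _) #|S| #|node Q| => z s n s0 sn z0.
case: (i0 \in S); nia.
Qed.

(** For proper nonempty [S] the sum of [theta] is $n\zeta(S)$ up to an error less than $n$ in
    absolute value, so $\zeta(S)\ge 1$ would make it positive. *)
Lemma theta_stable_zeta B S : stable (theta i0) B -> arrow_closed B S ->
  \sum_(i in S) zeta i <= 0.
Proof.
move=> st cS.
have [->|S0] := eqVneq S finset.set0; first by rewrite big_set0.
have [->|ST] := eqVneq S [set: node Q].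
  by rewrite (eq_bigl _ _ (fun i => @finset.in_setT _ i)) sum_zeta.
have := st S cS S0 ST; have /andP[] := card_proper S0 ST.
rewrite sum_theta_in.
move: (\sum_(i in S) _) #|S| #|node Q| => z s n s0 sn.
case: (i0 \in S); nia.
Qed.

End Theta.

(** * Critical points and weights *)

(** Algebraic form of the limit under the scaling with weights [W]. At an arrow of weight 1 the
    surviving terms of both gradients agree; at any other arrow each term with [c0 w] nonzero
    contains another arrow of nonzero weight, as the cycle has total weight 1. *)
Lemma grad_restrict (F : fieldType) (A : finType) (c c0 : {set A} -> F) (phi : A -> F) (W : A -> int) :
  (forall w, c0 w != 0 -> c w = c0 w) ->
  (forall w, c0 w != 0 -> \sum_(a in w) W a = 1) ->
  (forall a (w : {set A}), a \in w -> W a = 1 -> c w != 0 -> (forall b, b \in w :\ a -> phi b != 0) ->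
     c0 w = c w /\ forall b, b \in w :\ a -> W b = 0) ->
  (forall a, grad c phi a = 0) ->
  forall a, grad c0 (fun b => if W b == 0 then phi b else 0) a = 0.
Proof.
move=> c0c c0W top crit a.
have prod0 (w : {set A}) b : b \in w :\ a -> W b != 0 ->
    \prod_(b in w :\ a) (if W b == 0 then phi b else 0) = 0.
  by move=> bw /negbTE Wb; rewrite (bigD1 b) //= Wb mul0r.
have [Wa|Wa] := eqVneq (W a) 1; last first.
  rewrite /grad big1 // => w aw; have [->|c0w] := eqVneq (c0 w) 0; first by rewrite mul0r.
  have [/forall_inP W0|/forall_inPn[b bw Wb]] := boolP [forall b in w :\ a, W b == 0]; last first.
    by rewrite (prod0 w b) // mulr0.
  case/eqP: Wa; have := c0W w c0w; rewrite (big_setD1 a aw) /= big1 ?addr0 //.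
  by move=> b /W0/eqP.
rewrite -[RHS](crit a); apply: eq_bigr => w aw.
have [cw|cw] := eqVneq (c w) 0.
  have [->|/c0c] := eqVneq (c0 w) 0; first by rewrite cw !mul0r.
  by rewrite cw => <-; rewrite !mul0r.
have [/forall_inP p0|/forall_inPn[b bw]] := boolP [forall b in w :\ a, phi b != 0].
  have [-> W0] := top a w aw Wa cw p0; congr (_ * _).
  by apply: eq_bigr => b /W0->; rewrite eqxx.
rewrite negbK => /eqP pb; rewrite [X in _ = _ * X](bigD1 b) //= pb mul0r mulr0.
by rewrite (bigD1 b) //= pb if_same mul0r mulr0.
Qed.

Definition supp (F : nmodType) (A : finType) (phi : A -> F) : {set A} := finset (fun a => phi a != 0).

(* The total weight 1 - W b of the other arrows of a cycle through b is too small for an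
   arrow of weight at least m. *)
Lemma grad_low_weight (F : fieldType) (A : finType) (c : {set A} -> F) (phi y : A -> F)
    (W : A -> int) (m : int) :
  0 < m ->
  (forall w, c w != 0 -> \sum_(a in w) W a = 1) ->
  (forall a, phi a != 0 -> W a = 0) ->
  (forall a, y a != 0 -> 0 <= W a) ->
  (forall a, W a < m -> y a = phi a) ->
  forall b, 1 - m < W b -> grad c y b = grad c phi b.
Proof.
move=> m0 cW phiW yW yphi b Wb; apply: eq_bigr => w bw.
have [->|cw] := eqVneq (c w) 0; first by rewrite !mul0r.
congr (_ * _).
have [/forall_inP y0|/forall_inPn[a aw]] := boolP [forall a in w :\ b, y a != 0].
  apply: eq_bigr => a aw; apply: yphi; have := cW w cw.
  rewrite (big_setD1 b bw) /= (big_setD1 a aw) /= => E.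
  have : 0 <= \sum_(i in (w :\ b) :\ a) W i.
    by apply: sumr_ge0 => i; rewrite inE => /andP[_ /y0 /yW].
  move: E; set s := (\sum_(i in _) _); move: s Wb => s; lia.
rewrite negbK => /eqP ya; have [pa|pa] := eqVneq (phi a) 0.
  by rewrite !(bigD1 a aw) /= ya pa !mul0r.
by have := yphi a; rewrite (phiW a pa) ya => /(_ m0) E; rewrite -E eqxx in pa.
Qed.

(** * Redundancy of the critical equations by gauge invariance *)

Section Gauge.
Variables (F : fieldType) (Q : quiver) (c : {set arrow Q} -> F).
Hypothesis c_cycle : forall w, c w != 0 -> w \in simple_cycles Q.

(** Infinitesimal invariance of the potential under rescaling at the node [i]: every cycle enters
    [i] as often as it leaves it. *)
Lemma gauge_identity (y : arrow Q -> F) (i : node Q) :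
  \sum_a grad c y a * (y a * ((tgt a == i)%:R - (src a == i)%:R)) = 0.
Proof.
rewrite /grad; under eq_bigr do rewrite mulr_suml big_mkcond /=.
rewrite exchange_big /= big1 // => w _; rewrite -big_mkcond /=.
have [cw|/c_cycle wQ] := eqVneq (c w) 0; first by rewrite big1 // => a _; rewrite cw !mul0r.
rewrite (eq_bigr (fun a => (c w * \prod_(b in w) y b) * ((tgt a == i)%:R - (src a == i)%:R))).
  by rewrite -mulr_sumr sumrB -(simple_cycle_balance (fun j => (j == i)%:R : F) wQ) subrr mulr0.
by move=> a aw; rewrite (big_setD1 a aw) /=; ring.
Qed.

(* T is a set of rows of maximal rank of the boundary matrix. *)
Lemma gauge_basis (th : node Q -> int) (phi : arrow Q -> F) (i0 : node Q) :
  \sum_i th i = 0 -> stable th (supp phi) ->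
  exists T : {set arrow Q}, [/\ (#|node Q|.-1 <= #|T|)%N, T \subset supp phi &
    forall e : arrow Q -> F,
      (forall i, \sum_a e a * (phi a * ((tgt a == i)%:R - (src a == i)%:R)) = 0) ->
      (forall a, a \in supp phi -> a \notin T -> e a = 0) -> forall a, a \in T -> e a = 0].
Proof.
move=> th0 st.
pose M : 'M[F]_(#|arrow Q|, #|node Q|) := \matrix_(x, k)
  (phi (enum_val x) * ((tgt (enum_val x) == enum_val k)%:R - (src (enum_val x) == enum_val k)%:R)).
have kerM : (kermx M^T <= (const_mx 1 : 'rV[F]_#|node Q|))%MS.
  apply/rV_subP => v /sub_kermxP vM.
  have vE a : phi a * (v 0 (enum_rank (tgt a)) - v 0 (enum_rank (src a))) = 0.
    have := congr1 (fun m : 'rV_#|arrow Q| => m 0 (enum_rank a)) vM; rewrite !mxE => <-.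
    have pick (j : node Q) : \sum_k v 0 k * (j == enum_val k)%:R = v 0 (enum_rank j).
      rewrite (bigD1 (enum_rank j)) //= enum_rankK eqxx mulr1 big1 ?addr0 // => k kj.
      by rewrite (_ : (j == enum_val k) = false) ?mulr0 //; apply: contraNF kj => /eqP->; rewrite enum_valK.
    rewrite -!pick -sumrB mulr_sumr; apply: eq_bigr => k _.
    by rewrite !mxE enum_rankK; ring.
  (* A kernel vector is constant along the support, so this level set and its complement are both
     closed. Stability would give both negative weight, so the level set contains all nodes. *)
  pose S := finset (fun i => v 0 (enum_rank i) == v 0 (enum_rank i0)).
  have Sst a : a \in supp phi -> (tgt a \in S) = (src a \in S).
    rewrite !inE => pa; congr (_ == _); apply/eqP; rewrite -subr_eq0.
    by have /eqP := vE a; rewrite mulf_eq0 (negbTE pa).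
  have [ST|ST] := eqVneq S [set: node Q].
    apply/sub_rVP; exists (v 0 (enum_rank i0)); apply/rowP => k; rewrite !mxE mulr1.
    have : enum_val k \in S by rewrite ST inE.
    by rewrite inE enum_valK => /eqP.
  have S0 : S != finset.set0 by apply/set0Pn; exists i0; rewrite inE.
  have cS : arrow_closed (supp phi) S by move=> a aB; rewrite Sst.
  have := st S cS S0 ST.
  have := st (~: S); rewrite sum_setC // => H1 H2.
  have : - \sum_(i in S) th i < 0.
    apply: H1 => [a aB||]; first by rewrite !finset.in_setC Sst.
      by apply: contra_neq ST => E; rewrite -[S]finset.setCK E finset.setC0.
    by apply: contra_neq S0 => E; rewrite -[S]finset.setCK E finset.setCT.
  by rewrite oppr_lt0 => /(lt_trans H2); rewrite ltxx.
have rkM : (#|node Q|.-1 <= \rank M)%N.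
  have := mxrankS kerM; rewrite mxrank_ker mxrank_tr => /leq_trans/(_ (rank_leq_row _)); lia.
pose r x := enum_val (maxrankfun M x) : arrow Q.
have r_inj : injective r by move=> x x' /enum_val_inj /maxrankfun_inj.
have freeM := maxrowsub_free M.
exists (finset (mem (codom r))); split.
- by rewrite cardsE card_codom // card_ord.
- apply/fintype.subsetP => a; rewrite !inE => /codomP[x ->]; apply/eqP => px.
  have /(row_free_inj freeM)/rowP/(_ x) :
      (delta_mx 0 x : 'rV_(\rank M)) *m rowsub (maxrankfun M) M = 0 *m rowsub (maxrankfun M) M.
    by rewrite mul0mx -rowE; apply/rowP => k; rewrite !mxE -/(r x) px mul0r.
  by rewrite !mxE !eqxx => /eqP; rewrite oner_eq0.
move=> e eM e0 a; rewrite inE => /codomP[x ->].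
have /(row_free_inj freeM) /rowP/(_ x) : (\row_x e (r x)) *m rowsub (maxrankfun M) M = 0 *m rowsub (maxrankfun M) M.
  rewrite mul0mx; apply/rowP => k; rewrite !mxE -[RHS](eM (enum_val k)).
  rewrite [RHS](bigID [in codom r]) /= [X in _ + X]big1 ?addr0 => [|b br]; last first.
    have [pb|pb] := eqVneq (phi b) 0; first by rewrite pb mul0r mulr0.
    by rewrite (e0 b) ?mul0r // inE.
  have ucod : uniq (codom r) by rewrite map_inj_uniq ?enum_uniq.
  rewrite -(big_uniq _ ucod) /= big_image /=.
  by apply: eq_bigr => z _; rewrite !mxE.
by rewrite !mxE.
Qed.
End Gauge.

(** Weighted homogeneity: the other arrows of a cycle through [b] have total weight [1 - W b]. *)
Lemma grad_scale (F : fieldType) (A : finType) (c : {set A} -> F) (y y' : A -> F)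
    (W : A -> int) (s : F) :
  (forall w, c w != 0 -> \sum_(a in w) W a = 1) ->
  (forall a, y a != 0 -> 0 <= W a) ->
  (forall a, y' a = s ^+ absz (W a) * y a) ->
  forall b, W b <= 1 -> grad c y' b = s ^+ absz (1 - W b) * grad c y b.
Proof.
move=> cW yW y'E b Wb; rewrite /grad mulr_sumr; apply: eq_bigr => w bw.
have [->|cw] := eqVneq (c w) 0; first by rewrite !mul0r mulr0.
rewrite mulrCA; congr (_ * _).
have [/forall_inP y0|/forall_inPn[a aw]] := boolP [forall a in w :\ b, y a != 0]; last first.
  rewrite negbK => /eqP ya; rewrite (bigD1 a aw) /= y'E ya mulr0 mul0r.
  by rewrite [X in _ = _ * X](bigD1 a aw) /= ya mul0r mulr0.
under eq_bigr do rewrite y'E; rewrite big_split /= -expr_sum; congr (_ ^+ _ * _).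
apply/eqP; rewrite -eqz_nat gez0_abs ?subr_ge0 //.
have -> : 1 - W b = \sum_(a in w :\ b) W a.
  by have := cW w cw; rewrite (big_setD1 b bw) /=; move: (\sum_(a in _) _) => u; lia.
rewrite -natz natr_sum; apply/eqP.
by apply: eq_bigr => a /y0/yW Wa; rewrite natz gez0_abs.
Qed.

(** The total weight is $\sum_j (U_j - L_j)$ over the levels. Pairing $U_{j+1}$ with $L_j$ leaves at
    most $U_0$, the number of arrows of positive weight. *)
Lemma weight_count (A : finType) (W : A -> int) (k q : nat) :
  k%:Z <= \sum_a W a ->
  (forall m : nat, #|finset (fun a => (m.+2%:Z <= W a)%R)| <=
     #|finset (fun a => (W a <= - m.+1%:Z)%R)|)%N ->
  (#|finset (fun a => (1 <= W a)%R)| + q <= #|finset (fun a => (W a <= 0)%R)|)%N ->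
  (2 * k + q <= #|A|)%N.
Proof.
move=> kW Hm H1.
pose N := (\sum_a absz (W a))%N.
have WN a : (absz (W a) <= N)%N by rewrite /N (bigD1 a) //= leq_addr.
pose U j := #|finset (fun a => j.+1%:Z <= W a)|.
pose L j := #|finset (fun a => W a <= - j.+1%:Z)|.
have cardE (P : pred A) : #|finset P|%:Z = \sum_a (P a)%:Z.
  by rewrite -sum1_card -natz natr_sum big_mkcond; apply: eq_bigr => a _; rewrite inE; case: (P a).
have ind (n M : nat) : (n <= M)%N -> n%:Z = \sum_(j < M) ((j < n)%N)%:Z.
  move=> nM; rewrite -[in LHS](card_ord n) -sum1_card (big_ord_widen M (fun _ => 1%N) nM).
  by rewrite -natz natr_sum big_mkcond; apply: eq_bigr => j _; case: (_ < _)%N.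
have WE : \sum_a W a = \sum_(j < N.+1) (U j)%:Z - \sum_(j < N.+1) (L j)%:Z.
  rewrite -sumrB; under [RHS]eq_bigr do rewrite !cardE -sumrB.
  rewrite exchange_big /=; apply: eq_bigr => a _; rewrite sumrB.
  case: (lerP 0 (W a)) => Wa.
    rewrite [X in _ - X]big1 ?subr0 => [|j _]; last by rewrite (_ : (_ <= _) = false) //; lia.
    rewrite -[LHS](gez0_abs Wa) (ind _ N.+1); last by rewrite ltnW // ltnS.
    by apply: eq_bigr => j _; congr (nat_of_bool _)%:Z; lia.
  rewrite [X in X - _]big1 ?sub0r => [|j _]; last by rewrite (_ : (_ <= _) = false) //; lia.
  rewrite -[LHS]opprK -[X in - X](ltz0_abs Wa) (ind _ N.+1); last by rewrite ltnW // ltnS.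
  by congr (- _); apply: eq_bigr => j _; congr (nat_of_bool _)%:Z; lia.
have UL : \sum_a W a <= (U 0)%:Z.
  rewrite WE big_ord_recl [X in _ - X]big_ord_recr /= lerBlDr lerD2l.
  apply: (@le_trans _ _ (\sum_(j < N) (L j)%:Z)); last by rewrite lerDl.
  by apply: ler_sum => j _; rewrite lez_nat; apply: Hm.
have kU : (k <= U 0)%N by rewrite -lez_nat (le_trans kW).
have UA : (U 0 + #|finset (fun a => (W a <= 0)%R)| <= #|A|)%N.
  rewrite -(cardsC (finset (fun a => W a <= 0))) addnC leq_add2l subset_leq_card //.
  by apply/fintype.subsetP => a; rewrite !inE; lia.
rewrite -/(U 0) in H1; move: (U 0) kU UA H1 => u; lia.
Qed.

(** * Minimal configurations *)

Section Configurations.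
Variables (F : numClosedFieldType) (Q : quiver) (I : {set arrow Q}) (c : {set arrow Q} -> F).
Variable th : node Q -> int.
Hypothesis uncF : ~ countable [set: F].
Hypothesis c_cut : forall w, c w != 0 -> w \in cut_cycles I.
Hypothesis cutI : weak_cut I.
Hypothesis vanish : forall phi, (forall a, grad c phi a = 0) ->
  forall w, w \in cut_cycles I -> \prod_(a in w) phi a = 0.
Hypothesis th_sum : \sum_i th i = 0.
Hypothesis th_gen : forall S, S != finset.set0 -> S != [set: node Q] -> \sum_(i in S) th i != 0.

(* A fixed point, up to gauge, of the action scaling the arrows of I. *)
Definition config (phi : arrow Q -> F) (f : node Q -> int) : Prop :=
  [/\ forall a, grad c phi a = 0, stable th (supp phi) & forall a, phi a != 0 -> wt I f a = 0].

Lemma sum_wt_cut f w : c w != 0 -> \sum_(a in w) wt I f a = 1.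
Proof.
by move=> /c_cut; rewrite inE => /andP[wQ /eqP wI]; rewrite sum_wt_cycle // wI.
Qed.

Lemma stable_le (B : {set arrow Q}) S : stable th B -> arrow_closed B S -> \sum_(i in S) th i <= 0.
Proof.
move=> st cS.
have [->|S0] := eqVneq S finset.set0; first by rewrite big_set0.
have [->|ST] := eqVneq S [set: node Q].
  by rewrite (eq_bigl _ _ (fun i => @finset.in_setT _ i)) th_sum.
exact/ltW/st.
Qed.

(** The number of nodes reachable along [B] does not increase along an arrow of [B]. It drops along
    an arrow of [I], because a way back would close a cycle of $Q_2^I$ inside [B]. *)
Lemma acyclic_feasible (B : {set arrow Q}) :
  (forall w, w \in cut_cycles I -> ~~ (w \subset B)) ->
  feasible B (fun a => - (a \in I)%:Z)
    (fun i => #|finset (connect (arrow_rel B) i)|).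
Proof.
move=> acB a aB.
have sub : finset (connect (arrow_rel B) (tgt a)) \subset finset (connect (arrow_rel B) (src a)).
  apply/fintype.subsetP => i; rewrite !inE; apply: connect_trans.
  exact/connect1/arrow_relP.
have [aI|aI] := boolP (a \in I); last first.
  by rewrite oppr0 add0r subr_ge0 lez_nat subset_leq_card.
have [ba|nba] := boolP (connect (arrow_rel B) (tgt a) (src a)).
  have [w wQ /andP[aw wB]] := simple_cycle_through aB ba.
  have /acB : w \in cut_cycles I.
    rewrite inE wQ eqn_leq (forall_inP cutI w wQ) card_gt0; apply/set0Pn.
    by exists a; rewrite inE aw.
  by rewrite wB.
suff : (#|finset (connect (arrow_rel B) (tgt a))| < #|finset (connect (arrow_rel B) (src a))|)%N.
  by move: #|_| #|_| => u v; lia.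
apply: proper_card; rewrite properE sub; apply/subsetPn; exists (src a); rewrite inE //.
Qed.

(** By vanishing, the support of [y] contains no cycle of $Q_2^I$, so [y] can be degenerated with
    weights [wt I f'] at most 0 on its support. Then [f' - f] is nondecreasing along the support of
    [phi] and strictly grows along [a0], so its pairing with [th] is negative. *)
Lemma config_step phi f y : config phi f -> (forall a, grad c y a = 0) ->
  (forall a, wt I f a <= 0 -> y a = phi a) ->
  (exists2 a, y a != 0 & 0 < wt I f a) ->
  exists phi' f', config phi' f' /\ \sum_i th i * f' i < \sum_i th i * f i.
Proof.
move=> [crit st phiW] ycrit yphi [a0 ya0 Wa0].
have sub : supp phi \subset supp y.
  apply/fintype.subsetP => a; rewrite !inE => pa; rewrite yphi // phiW //.
have sty : stable th (supp y) := stableS sub st.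
have acy w : w \in cut_cycles I -> ~~ (w \subset supp y).
  move=> /(vanish ycrit)/eqP; apply: contraTN => /fintype.subsetP wy.
  by apply/prodf_neq0 => a /wy; rewrite inE.
have cle a : `| - (a \in I)%:Z| <= 1 :> int by case: (_ \in _).
have [h fh hst] := feasible_stable th_sum th_gen sty cle (acyclic_feasible acy).
pose f' i : int := - (h i)%:Z.
have wtE a : wt I f' a = - (- (a \in I)%:Z + (h (src a))%:Z - (h (tgt a))%:Z).
  by rewrite /wt /f'; lia.
have Wle a : y a != 0 -> wt I f' a <= 0.
  by move=> ya; rewrite wtE oppr_le0; apply: fh; rewrite inE.
exists (fun b => if wt I f' b == 0 then y b else 0), f'; split; first split.
- apply: (grad_restrict (c := c)) ycrit => [//|w|a w aw Wa cw y0]; first exact: sum_wt_cut.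
  split=> // b bw; have := sum_wt_cut f' cw; rewrite (big_setD1 a aw) /= Wa (big_setD1 b bw) /=.
  have : \sum_(i in (w :\ a) :\ b) wt I f' i <= 0.
    by apply: sumr_le0 => i; rewrite inE => /andP[_ /y0 /Wle].
  have := Wle b (y0 b bw); move: (wt I f' b) (\sum_(i in _) _) => u v; lia.
- rewrite (_ : supp _ = finset (fun a => (a \in supp y) && (- (a \in I)%:Z + (h (src a))%:Z - (h (tgt a))%:Z == 0))) //.
  apply/setP => a; rewrite !inE wtE oppr_eq0.
  by case: (_ + _ - _ == 0); rewrite ?andbT ?andbF ?eqxx.
- by move=> a; have [//|_] := eqVneq (wt I f' a) 0; rewrite eqxx.
have mono a : y a != 0 -> 0 <= wt I f a ->
    f' (src a) - f (src a) + wt I f a <= f' (tgt a) - f (tgt a).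
  by move=> /Wle; rewrite /wt; lia.
have [|_ /(_ st) lt] := @monotone_pairing _ th (supp phi) (fun i => f' i - f i) th_sum
  (fun S => @stable_le (supp phi) S st).
  move=> a aB; have := mono a; have := aB; rewrite inE => /phiW ->.
  by move: (fintype.subsetP sub a aB); rewrite inE addr0 lexx => ya /(_ ya isT).
rewrite -subr_lt0 -sumrB; under eq_bigr do rewrite -mulrBr; apply: lt.
exists (src a0), (tgt a0); apply: lt_le_trans (mono a0 ya0 (ltW Wa0)).
by rewrite ltrDl.
Qed.


Lemma config_value phi f phi' f' : config phi f -> config phi' f' -> supp phi = supp phi' ->
  \sum_i th i * f i <= \sum_i th i * f' i.
Proof.
move=> [_ st phiW] [_ _ phiW'] sE.
have [|le _] := @monotone_pairing _ th (supp phi) (fun i => f i - f' i) th_sum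
  (fun S => @stable_le (supp phi) S st).
  move=> a aB; have := aB; rewrite {1}sE !inE => /phiW'.
  by move: aB; rewrite inE => /phiW; rewrite /wt; lia.
by rewrite -subr_le0 -sumrB; under eq_bigr do rewrite -mulrBr.
Qed.

(** The value depends only on the support, by [config_value] in both directions, and there are
    finitely many supports. *)
Lemma exists_min_config phi0 f0 : config phi0 f0 -> exists phi f, config phi f /\
  forall phi' f', config phi' f' -> \sum_i th i * f i <= \sum_i th i * f' i.
Proof.
move=> c0.
have /choice[v vP] (B : {set arrow Q}) : exists v : int, forall phi f, config phi f -> supp phi = B ->
    \sum_i th i * f i = v.
  have [[phi [f [cf sB]]]|no] := pselect (exists phi f, config phi f /\ supp phi = B).
    exists (\sum_i th i * f i) => phi' f' cf' sB'; apply/eqP; rewrite eq_le.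
    by rewrite (config_value cf' cf) ?(config_value cf cf') // ?sB ?sB'.
  by exists 0 => phi f cf sB; case: no; exists phi, f.
pose P B := `[< exists phi f, config phi f /\ supp phi = B >].
have P0 : P (supp phi0) by apply/asboolP; exists phi0, f0.
have [B /asboolP[phi [f [cf sB]]] minB] := Order.TotalTheory.arg_minP v P0.
exists phi, f; split => // phi' f' cf'.
rewrite (vP B _ _ cf sB) (vP _ _ _ cf' erefl); apply: minB.
by apply/asboolP; exists phi', f'.
Qed.

(* The equations of low weight are weighted homogeneous in the variables of weight at
   least m. *)
Lemma positive_extension phi f (m : nat) (T : {set arrow Q}) : config phi f -> (0 < m)%N ->
  T \subset finset (fun a => wt I f a <= 1 - m%:Z) ->
  (#|finset (fun a => (wt I f a <= 1 - m%:Z)%R)| < #|finset (fun a => (m%:Z <= wt I f a)%R)| + #|T|)%N ->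
  (forall y, (forall a, wt I f a < m%:Z -> y a = phi a) -> (forall a, y a != 0 -> 0 <= wt I f a) ->
     (forall b, b \notin T -> grad c y b = 0) -> forall b, b \in T -> grad c y b = 0) ->
  exists y, [/\ forall a, grad c y a = 0, forall a, wt I f a < m%:Z -> y a = phi a &
    exists2 a, y a != 0 & m%:Z <= wt I f a].
Proof.
move=> [crit _ phiW] m0 Tsub cardX HT.
pose W := wt I f.
have cW w : c w != 0 -> \sum_(a in w) W a = 1 by apply: sum_wt_cut.
pose X := {a : arrow Q | m%:Z <= W a}.
pose low := finset (fun a => W a <= 1 - m%:Z).
pose J := {b : arrow Q | b \in low :\: T}.
(* The powers turn weighted homogeneity into ordinary homogeneity. As the weights on [X] are
   positive, a nonzero coordinate gives a nonzero arrow. *)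
pose ext (z : X -> F) a : F := if insub a is Some u then z u ^+ absz (W a) else phi a.
have extX z (u : X) : ext z (val u) = z u ^+ absz (W (val u)) by rewrite /ext valK.
have extN z a : W a < m%:Z -> ext z a = phi a by move=> Wa; rewrite /ext insubN // -ltNge.
have extW z a : ext z a != 0 -> 0 <= W a.
  have [Wa|Wa] := ltrP (W a) m%:Z; first by rewrite extN // /W => /phiW->.
  by move=> _; apply: le_trans Wa.
have extS (s : F) z a : ext (fun u => s * z u) a = s ^+ absz (W a) * ext z a.
  rewrite /ext; case: insubP => [u _ _|Wa]; first by rewrite exprMn.
  have [->|/phiW Wa0] := eqVneq (phi a) 0; first by rewrite mulr0.
  by rewrite /W Wa0 expr0 mul1r.
have lowJ (b : J) : W (val b) <= 1 - m%:Z by have := valP b; rewrite !inE => /andP[].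
have [||||z [u zu] zE] := @homogeneous_common_zero F X J uncF
    (fun b z => grad c (ext z) (val b)) (fun b => absz (1 - W (val b))).
- move=> b; apply: (polyfun_grad c (x := ext)) => a; rewrite /ext.
  case: insubP => [u _ _|_]; last exact: polyfun_cst.
  exact/polyfunX/polyfun_coord.
- by move=> b /=; have := lowJ b; move: (W (val b)) m0 => x; lia.
- move=> b s z; apply: (grad_scale cW (extW z) (extS s z)); have := lowJ b.
  by move: (W (val b)) m0 => x; lia.
- rewrite !card_sig.
  have -> : #|[pred b | b \in low :\: T]| = (#|low| - #|T|)%N.
    by rewrite -[in RHS](finset.setIidPr Tsub) -cardsD; apply: eq_card.
  have -> : #|[pred a | m%:Z <= W a]| = #|finset (fun a => (m%:Z <= W a)%R)|.
    by apply: eq_card => a; rewrite inE.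
  have := subset_leq_card Tsub; rewrite -/low; move: cardX; rewrite -/W -/low.
  by move: #|low| #|T| #|_| => ? ? ?; lia.
have gradN b : b \notin T -> grad c (ext z) b = 0.
  move=> bT; have [Wb|Wb] := lerP (W b) (1 - m%:Z).
    have bJ : b \in low :\: T by rewrite !inE bT.
    exact: (zE (exist _ b bJ)).
  rewrite (grad_low_weight (m := m%:Z) (W := W) _ cW phiW (extW z) _ Wb) ?crit //.
  by move=> a; apply: extN.
exists (ext z); split => [b||].
- have [bT|/gradN//] := boolP (b \in T).
  by apply: (HT (ext z)) => // a; [apply: extN|apply: extW].
- by move=> a; apply: extN.
- by exists (val u); [rewrite extX expf_neq0|exact: (valP u)].
Qed.

Hypothesis zeta_le : forall B S, stable th B -> arrow_closed B S -> \sum_(i in S) zeta i <= 0.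

Lemma config_inequality phi f (i0 : node Q) : config phi f ->
  (2 * #|I| + #|node Q|.-1 <= #|arrow Q|)%N.
Proof.
move=> /exists_min_config[{}phi [{}f [cf fmin]]].
have [crit st phiW] := cf.
(* With too few equations there would be another critical point, hence by [config_step] a
   configuration of smaller value. *)
have noext (m : nat) (T : {set arrow Q}) : (0 < m)%N ->
    T \subset finset (fun a => wt I f a <= 1 - m%:Z) ->
    (forall y, (forall a, wt I f a < m%:Z -> y a = phi a) -> (forall a, y a != 0 -> 0 <= wt I f a) ->
     (forall b, b \notin T -> grad c y b = 0) -> forall b, b \in T -> grad c y b = 0) ->
    (#|finset (fun a => (m%:Z <= wt I f a)%R)| + #|T| <= #|finset (fun a => (wt I f a <= 1 - m%:Z)%R)|)%N.
  move=> m0 Tsub HT; rewrite leqNgt; apply/negP => card.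
  have [y [ycrit yphi [a ya Wa]]] := positive_extension cf m0 Tsub card HT.
  have [||phi' [f' [cf' lt]]] := config_step cf ycrit.
  - by move=> b Wb; apply: yphi; apply: le_lt_trans Wb _; rewrite ltz_nat.
  - by exists a => //; apply: lt_le_trans Wa; rewrite ltz_nat.
  by have := fmin _ _ cf'; rewrite leNgt lt.
have [T [Tcard Tsub TP]] := gauge_basis i0 th_sum st.
have c_cycle w : c w != 0 -> w \in simple_cycles Q by move=> /c_cut; rewrite inE => /andP[].
apply: (@weight_count _ (wt I f)).
(* Zero weight on the support means that [f] grows by 1 along arrows of [I] and is constant along
   the others, so its pairing with [zeta] is nonpositive. *)
- rewrite sum_wt lerBrDr gerDl.
  have [|le _] := @monotone_pairing _ (@zeta Q) (supp phi) f (sum_zeta Q)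
    (fun S => @zeta_le (supp phi) S st) => //.
  move=> a; rewrite inE => /phiW; rewrite /wt; lia.
- move=> m; have := noext m.+2 finset.set0; rewrite cards0 addn0 finset.sub0set.
  move=> /(_ isT isT) H; apply: leq_trans (H _) _; first by move=> y _ _ _ b; rewrite inE.
  by apply/eq_leq/eq_card => a; rewrite !inE; congr (_ <= _); lia.
apply: leq_trans (noext 1%N T _ _ _); rewrite ?leq_add2l //.
  apply: (fintype.subset_trans Tsub); apply/fintype.subsetP => a.
  by rewrite !inE => /phiW->; rewrite subrr.
(* For [m = 1] the gradient of [y] vanishes at arrows of positive weight, so in the gauge identity
   [y] may be replaced by [phi]; the equations in [T] then follow from the others. *)
move=> y yphi yW gradN b bT; apply: (TP (grad c y)) bT => [i|a _ /gradN//].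
rewrite -[RHS](gauge_identity c_cycle y i); apply: eq_bigr => a _.
have [Wa|Wa] := ltrP (wt I f a) 1; first by rewrite yphi.
rewrite (grad_low_weight (m := 1) (W := wt I f) _ _ phiW yW yphi) ?crit ?mul0r //.
  by move=> w; apply: sum_wt_cut.
Qed.

End Configurations.

(** * The inequality *)

(** The zero potential is feasible for $1_I$. Optimising it gives nonnegative weights on the support
    of [phi], and the arrows of weight 0 there remain stable. *)
Lemma self_stable_config (R : realType) (Q : quiver) (I : {set arrow Q}) (i0 : node Q)
    (nu : coeffs R (simple_cycles Q)) (phi : abelian_rep R Q) :
  weak_cut I -> (forall a, grad (coef nu) phi a = 0) -> self_stable phi ->
  exists phi' f, config I (coef (cut_proj (I := I) nu)) (theta i0) phi' f.
Proof.
move=> cutI crit st.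
have stB : stable (theta i0) (supp phi).
  apply: theta_stable => S cS; apply: st => a sa pa; apply: (cS a) => //.
  by rewrite inE.
have fh0 : feasible (supp phi) (fun a => (a \in I)%:Z) (fun _ => 0%N).
  by move=> a _; rewrite addr0 subr0.
have cle a : `|(a \in I)%:Z| <= 1 :> int by case: (_ \in _).
have [h fh hst] := feasible_stable (sum_theta i0) (@theta_generic Q i0) stB cle fh0.
pose f i := (h i)%:Z.
have W0 a : phi a != 0 -> 0 <= wt I f a by move=> pa; apply: fh; rewrite inE.
exists (fun b => if wt I f b == 0 then phi b else 0), f; split.
- have coefI w : w \in cut_cycles I -> coef (cut_proj (I := I) nu) w = coef nu w.
    move=> wI; rewrite -[w]/(val (exist (fun w => w \in cut_cycles I) w wI)) coefE.
    rewrite /cut_proj /= -(coefE nu); congr coef.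
  have inI w : coef (cut_proj (I := I) nu) w != 0 -> w \in cut_cycles I.
    by apply: contraR => wI; rewrite coef_notin.
  apply: (grad_restrict (c := coef nu)) crit => [w /inI/coefI //|w /inI|a w aw Wa cw p0].
    by rewrite inE => /andP[wQ /eqP wI]; rewrite sum_wt_cycle // wI.
  have wQ : w \in simple_cycles Q by apply: contraR cw => wQ; rewrite coef_notin.
  (* One arrow has weight 1, the others nonnegative weight, and the total is at most 1 for a weak
     cut: the cycle lies in $Q_2^I$ and its other arrows have weight 0. *)
  have := sum_wt_cycle I f wQ; rewrite (big_setD1 a aw) /= Wa => E.
  have le1 : (#|w :&: I| <= 1)%N := forall_inP cutI w wQ.
  have sge : 0 <= \sum_(b in w :\ a) wt I f b by apply: sumr_ge0 => b /p0/W0.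
  have s0 : \sum_(b in w :\ a) wt I f b = 0.
    by move: sge E le1; move: (\sum_(b in w :\ a) _) => s; lia.
  split; first by rewrite coefI // inE wQ -eqz_nat -E s0.
  by move=> b bw; apply: (psumr_eq0P _ s0) => // d /p0/W0.
- rewrite (_ : supp _ = finset (fun a => (a \in supp phi) &&
     ((a \in I)%:Z + (h (src a))%:Z - (h (tgt a))%:Z == 0))) //.
  apply/setP => a; rewrite !inE -/(wt I f a).
  by case: (wt I f a == 0); rewrite ?andbT ?andbF ?eqxx.
- by move=> a; have [//|_] := eqVneq (wt I f a) 0; rewrite eqxx.
Qed.

Theorem propositionA10 (R : realType) (Q : quiver) (hQ : connected_quiver Q) :
  exists U : forall I : {set arrow Q}, set (coeffs R (cut_cycles I)),
    [/\ forall I : {set arrow Q}, weak_cut I ->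
          [/\ open (U I), dense (U I) & vanishing (U I)],
        open (generic U),
        dense (generic U)
      & forall nu : coeffs R (simple_cycles Q), generic U nu ->
        (exists phi : abelian_rep R Q, is_abelian_rep nu phi /\ self_stable phi) ->
        forall I : {set arrow Q}, weak_cut I ->
          (#|I|%:Z <= #|~: I|%:Z - #|node Q|%:Z + 1)%R].
Proof.
have ex : forall I : {set arrow Q}, exists p : ({w | w \in cut_cycles I} -> R[i]) -> R[i],
  [/\ polyfun p, exists x, p x != 0 &
      forall nu : coeffs R (cut_cycles I), p nu != 0 -> forall phi : abelian_rep R Q,
        (forall a, grad (coef nu) phi a = 0) ->
        forall w, w \in cut_cycles I -> \prod_(a in w) phi a = 0].
  by move=> I; apply: (@vanishing_polyfun R Q _ I) => w; rewrite inE => /andP[_ /eqP].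
pose p I := sval (cid (ex I)); have pP I := svalP (cid (ex I)); rewrite -/(p _) in pP.
pose U I : set (coeffs R (cut_cycles I)) := [set nu | p I nu != 0]%classic.
(* The generic locus is the nonvanishing locus of this single polynomial, hence open and dense. *)
pose P (nu : {w | w \in simple_cycles Q} -> R[i]) :=
  \prod_(I : {set arrow Q} | weak_cut I) p I (cut_proj (I := I) nu).
have pI I : polyfun (fun nu : {w | w \in simple_cycles Q} -> R[i] => p I (cut_proj (I := I) nu)).
  have [pp _ _] := pP I.
  by apply: (polyfun_comp (s := fun w nu => nu _)) pp => w; apply: polyfun_coord.
have Ppoly : polyfun P by apply: polyfun_prod => I _.
have PU : generic U = [set nu : coeffs R (simple_cycles Q) | P nu != 0]%classic.
  apply/seteqP; split => nu /=; first by move=> H; apply/prodf_neq0 => I; apply: H.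
  by move=> /prodf_neq0 H I; apply: H.
have P0 : exists x, P x != 0.
  pose q (I : {set arrow Q}) (nu : {w | w \in simple_cycles Q} -> R[i]) : R[i] :=
    if weak_cut I then p I (cut_proj (I := I) nu) else 1.
  have [||x qx] := polyfun_prod_neq0 (index_enum {set arrow Q}) (p := q).
  - by move=> I; rewrite /q; case: (weak_cut I) => //; apply: polyfun_cst.
  - move=> I; have [_ [x px] _] := pP I.
    (* Extended by zero to all simple cycles, the witness [x] projects back to itself under
       [cut_proj]. *)
    exists (fun w => coef (x : coeffs R (cut_cycles I)) (val w)); rewrite /q.
    case: (weak_cut I); last by rewrite oner_eq0.
    rewrite (_ : cut_proj _ = x) //; apply/funext => u.
    exact: (coefE (x : coeffs R (cut_cycles I))).
  - by exists x; rewrite /P big_mkcond.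
exists U; split.
- move=> I _; have [pp p0 pV] := pP I; split.
  + exact: polyfun_neq0_open.
  + exact: polyfun_neq0_dense.
  + move=> nu Unu phi crit; apply: (pV nu Unu) => a; rewrite -partial_potential; exact: crit.
- by rewrite PU; apply: polyfun_neq0_open.
- by rewrite PU; apply: polyfun_neq0_dense.
move=> nu gnu [phi [crit st]] I cutI.
have [/card_gt0P[i0 _] _] := hQ.
have [|phi' [f cf]] := @self_stable_config R Q I i0 nu phi cutI _ st.
  by move=> a; rewrite -partial_potential; exact: crit.
have cut_coef w : coef (cut_proj (I := I) nu) w != 0 -> w \in cut_cycles I.
  by apply: contraR => wI; rewrite coef_notin.
have [_ _ pV] := pP I.
have := config_inequality (@uncountable_complex R) cut_coef cutI (pV _ (gnu I cutI))
  (sum_theta i0) (@theta_generic Q i0) (@theta_stable_zeta Q i0) i0 cf.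
(* It remains to combine $2|I| + |Q_0| - 1 \le |Q_1|$ with $|Q_1| = |I| + |Q_1 - I|$; a positive
   number of nodes makes the truncated predecessor exact. *)
have := cardsC I; have : (0 < #|node Q|)%N by apply/card_gt0P; exists i0.
move: #|I| #|~: I| #|node Q| #|arrow Q| => x y n m; lia.
Qed.
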